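(* Let $b\ge 2$ be an integer base, let $d\ge 1$ and let $p\ge 2$ be an integer. Let $f\in L^p[0,1]^d$ be real-valued, with ANOVA decomposition $f=\sum_{u\subseteq\{1,\dots,d\}}f_u$. Then for every $u\subseteq\{1,\dots,d\}$, $$\underline{\tau}^{[p]}_{u,\mathrm{wal}}+\mu_{\mathrm{wal}}^p=\sum_{v\subseteq u}\sigma_{p,\mathrm{wal}}(f_v).$$
   Context: Let $\mathcal{D}=\{1,\dots,d\}$ and $\mu_{\mathrm{wal}}=\int_{[0,1]^d}f(\boldsymbol{x})\,\mathrm{d}\boldsymbol{x}$ (the zeroth Walsh coefficient of $f$). For $u\subseteq\mathcal{D}$, $\boldsymbol{x}_u$ denotes the vector of components $x_j$ with $j\in u$, $\boldsymbol{x}_{-u}$ that of components with $j\notin u$, and $\boldsymbol{x}_u{:}\boldsymbol{y}_{-u}$ is the point of $[0,1]^d$ whose $j$'th component is $x_j$ for $j\in u$ and $y_j$ for $j\notin u$. ANOVA decomposition: the functions $f_u$ are defined recursively by $$f_u(\boldsymbol{x})=\int_{[0,1]^{d-|u|}}\Bigl(f(\boldsymbol{x})-\sum_{v\subsetneq u}f_v(\boldsymbol{x})\Bigr)\mathrm{d}\boldsymbol{x}_{-u},$$ so $f_\varnothing$ is the constant $\int f$, $f_u$ depends on $\boldsymbol{x}$ only through $\boldsymbol{x}_u$, and $f=\sum_{u\subseteq\mathcal{D}}f_u$. Digitwise subtraction: for real $x,y\ge 0$ with base $b$ expansions $x=\sum_{i=w}^{-\infty}x_ib^i$, $y=\sum_{i=w}^{-\infty}y_ib^i$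 (made unique by requiring infinitely many digits to differ from $b-1$), $x\ominus y=\sum_{i=w}^{-\infty}z_ib^i$ with $z_i\in\{0,\dots,b-1\}$, $z_i\equiv x_i-y_i\pmod b$. For vectors $\ominus$ acts componentwise; $\ominus\boldsymbol{x}=\boldsymbol{0}\ominus\boldsymbol{x}$; and $(\ominus1)^j\boldsymbol{x}$ equals $\boldsymbol{x}$ if $j$ is even and $\ominus\boldsymbol{x}$ if $j$ is odd. For $j\in\{0,\dots,p-1\}$ let $j+$ denote $j+1\pmod p$. For functions $f_0,\dots,f_{p-1}$ on $[0,1]^d$ define $$\langle f_0,\dots,f_{p-1}\rangle_{p,\mathrm{wal}}=\int_{[0,1]^{dp}}\prod_{j=0}^{p-1}f_j\bigl((\ominus1)^j(\boldsymbol{x}_j\ominus\boldsymbol{x}_{j+})\bigr)\,\mathrm{d}\boldsymbol{x}_0\cdots\mathrm{d}\boldsymbol{x}_{p-1},$$ and $\sigma_{p,\mathrm{wal}}(g)=\langle g,\dots,g\rangle_{p,\mathrm{wal}}$. For $u\subseteq\mathcal{D}$, $\underline{\tau}^{[p]}_{u,\mathrm{wal}}$ is defined by $$\underline{\tau}^{[p]}_{u,\mathrm{wal}}+\mu_{\mathrm{wal}}^p=\int_{[0,1]^{dp}}\prod_{j=0}^{p-1}f\bigl(\{(\ominus1)^j(\boldsymbol{x}_{u,j}\ominus\boldsymbol{x}_{u,j+})\}{:}\boldsymbol{y}_{-u,j}\bigr)\prod_{j=0}^{p-1}\mathrm{d}\boldsymbol{x}_{u,j}\prod_{j=0}^{p-1}\mathrm{d}\boldsymbol{y}_{-u,j},$$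 where $\{\cdot\}$ is the componentwise fractional part, $\boldsymbol{x}_{u,0},\dots,\boldsymbol{x}_{u,p-1}\in[0,1]^{|u|}$ have components indexed by $u$ and $\boldsymbol{y}_{-u,0},\dots,\boldsymbol{y}_{-u,p-1}\in[0,1]^{d-|u|}$ have components indexed by $\mathcal{D}\setminus u$. (Values on null sets, e.g. at coordinates equal to $1$, are irrelevant.) *)

(* Defs.v *)
From HB Require Import structures.
From mathcomp Require Import all_boot all_order all_algebra.
From mathcomp Require Import ring lra zify.
From mathcomp Require Import all_classical all_reals all_analysis.

Set Implicit Arguments.
Unset Strict Implicit.
Unset Printing Implicit Defensive.
Import Order.TTheory GRing.Theory Num.Theory.
Import numFieldNormedType.Exports.

Local Open Scope classical_set_scope.
Local Open Scope ring_scope.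

Section tuple_probability.
Context (disp : measure_display) (T : measurableType disp) (R : realType).

Definition tuple_cons (n : nat) (x : T * n.-tuple T) : n.+1.-tuple T :=
  [tuple of x.1 :: x.2].

Lemma measurable_tuple_cons (n : nat) : measurable_fun setT (@tuple_cons n).
Proof. exact: (measurable_cons measurable_fst measurable_snd). Qed.

HB.instance Definition _ (n : nat) :=
  isMeasurableFun.Build _ _ _ _ (@tuple_cons n) (@measurable_tuple_cons n).

(* The n-fold product of P; see tuple_prob_box. *)
Fixpoint tuple_prob (P : probability T R) (n : nat) :
    probability (n.-tuple T) R :=
  match n return probability (n.-tuple T) R with
  | 0%N => dirac (nil_tuple T)
  | n'.+1 => distribution (P \x tuple_prob P n')%E (@tuple_cons n')
  end.

Lemma measurable_tuple_box (n : nat) (A : 'I_n -> set T) :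
  (forall i, measurable (A i)) ->
  measurable [set t : n.-tuple T | forall i, A i (tnth t i)].
Proof.
move=> mA.
have -> : [set t : n.-tuple T | forall i, A i (tnth t i)] =
    \bigcap_(i in [set: 'I_n]) ((@tnth n T)^~ i @^-1` A i).
  by apply/seteqP; split=> [t At i _|t At i]; exact: At.
apply: fin_bigcap_measurable => // i _.
by rewrite -[X in measurable X]setTI; exact: measurable_tnth.
Qed.

Lemma tuple_prob_box (P : probability T R) (n : nat) (A : 'I_n -> set T) :
  (forall i, measurable (A i)) ->
  tuple_prob P n [set t | forall i, A i (tnth t i)] = (\prod_(i < n) P (A i))%E.
Proof.
elim: n A => [|n IHn] A mA.
  by rewrite big_ord0 /= diracE mem_set// => -[].
have mB : measurable
    [set t : n.-tuple T | forall i, A (lift ord0 i) (tnth t i)].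
  by apply: (@measurable_tuple_box n (fun i => A (lift ord0 i))).
rewrite big_ord_recl -(IHn (fun i => A (lift ord0 i)))//.
rewrite -(product_measure1E P (tuple_prob P n) (mA ord0) mB).
rewrite [LHS]/= /distribution /pushforward.
congr (_ _); apply/seteqP; split=> -[x t] /=.
  move=> At; split=> [|i]; first by have := At ord0; rewrite tnth0.
  by have := At (lift ord0 i); rewrite tnthS.
move=> [Ax At] i; case: (unliftP ord0 i) => [j ->|->].
  by rewrite tnthS; exact: At.
by rewrite tnth0.
Qed.

End tuple_probability.

Section digits.
Context {R : realType} (b : nat).
Implicit Types x y : R.

(* Coefficient of b ^ i, for i of either sign, in the base b expansion of
   x >= 0 that has infinitely many digits different from b - 1; see digitsE and
   digits_proper. *)
Definition digit x (i : int) : int :=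
  (Num.floor (x * b%:R ^ (- i)) %% b%:Z)%Z.

(* intdiv's remainder is the nonnegative one. *)
Definition digit_sub x y (i : int) : int :=
  ((digit x i - digit y i) %% b%:Z)%Z.

Lemma digit_itv x i : (0 < b)%N -> 0 <= digit x i < b%:Z.
Proof.
by move=> b0; rewrite /digit modz_ge0 ?ltz_pmod // -lt0n.
Qed.

(* The real with digits z: the first series collects the digits of nonnegative
   index, almost all 0 in the uses below, the second one the others. *)
Definition of_digits (z : int -> int) : R :=
  limn (series (fun k : nat => (z k%:Z)%:~R * b%:R ^ k%:Z : R)) +
  limn (series (fun k : nat => (z (- k.+1%:Z))%:~R * b%:R ^ (- k.+1%:Z) : R)).

Lemma digit_telescope x i : (0 < b)%N ->
  (digit x i)%:~R * b%:R ^ i =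
  (Num.floor (x * b%:R ^ (- i)))%:~R * b%:R ^ i -
  (Num.floor (x * b%:R ^ (- (i + 1))))%:~R * b%:R ^ (i + 1) :> R.
Proof.
move=> b0; have bn0 : b%:R != 0 :> R by rewrite pnatr_eq0 -lt0n.
have bgt0 : 0 < b%:R :> R by rewrite ltr0n.
set y := x * b%:R ^ (- i).
have -> : x * b%:R ^ (- (i + 1)) = y / b%:R.
  by rewrite /y opprD expfzDr// mulrA.
have -> : Num.floor (y / b%:R) = (Num.floor y %/ b%:Z)%Z.
  apply: floor_def; have := divz_eq (Num.floor y) b%:Z.
  set q := (_ %/ _)%Z; set r := (_ %% _)%Z => yE.
  have /andP[r0 rb] : 0 <= r < b%:Z by exact: digit_itv.
  rewrite ler_pdivlMr// ltr_pdivrMr//; apply/andP; split.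
    apply: le_trans (floor_le y); rewrite yE intrD intrM lerDl ler0z//.
  apply: (lt_le_trans (floorD1_gt y)).
  rewrite -[b%:R]/(b%:Z%:~R) -intrM ler_int yE mulrDl mul1r -addrA lerD2l.
  by rewrite lezD1.
rewrite expfzDr// expr1z mulrA mulrAC -mulrBl; congr (_ * _).
rewrite mulrC [b%:R](_ : _ = b%:Z%:~R)// -intrM -intrB; congr (_%:~R).
by rewrite /digit -/y {2}(divz_eq (Num.floor y) b%:Z) mulrC addrAC subrr add0r.
Qed.

Let digit_sum_neg x n : (0 < b)%N ->
  series (fun k => (digit x (- k.+1%:Z))%:~R * b%:R ^ (- k.+1%:Z) : R) n =
  (Num.floor (x * b%:R ^ n%:Z))%:~R * b%:R ^ (- n%:Z) - (Num.floor x)%:~R.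
Proof.
move=> b0; elim: n => [|n IHn].
  by rewrite /series/= big_geq// !expr0z !mulr1 subrr.
rewrite seriesSr IHn digit_telescope// opprK.
by rewrite (_ : - n.+1%:Z + 1 = - n%:Z) ?opprK; [ring | lia].
Qed.

Let digit_sum_pos x n : (0 < b)%N ->
  series (fun k => (digit x k%:Z)%:~R * b%:R ^ k%:Z : R) n =
  (Num.floor x)%:~R - (Num.floor (x * b%:R ^ (- n%:Z)))%:~R * b%:R ^ n%:Z.
Proof.
move=> b0; elim: n => [|n IHn].
  by rewrite /series/= big_geq// !expr0z !mulr1 subrr.
rewrite seriesSr IHn digit_telescope//.
by rewrite (_ : n%:Z + 1 = n.+1%:Z); [ring | lia].
Qed.

Let cvg_bVn : (1 < b)%N -> (b%:R ^ (- n%:Z) : R) @[n --> \oo] --> (0 : R).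
Proof.
move=> b1; have : `|b%:R^-1 : R| < 1.
  by rewrite ger0_norm ?invr_ge0// invf_lt1 ?ltr1n// ltr0n ltnW.
move/cvg_expr; apply: cvg_trans; apply: near_eq_cvg; near=> n.
by rewrite -exprz_inv.
Unshelve. all: by end_near. Qed.

Lemma digitsE x : (1 < b)%N -> 0 <= x -> of_digits (digit x) = x.
Proof.
move=> b1 x0; have b0 := ltnW b1.
have bgt0 n : 0 < b%:R ^ n%:Z :> R by rewrite exprz_gt0// ltr0n.
have bn0 : b%:R != 0 :> R by rewrite pnatr_eq0 -lt0n.
rewrite /of_digits -[RHS](subrK (Num.floor x)%:~R) addrC.
congr (_ + _); apply/cvg_lim => //.
- rewrite (funext (fun n => digit_sum_neg x n b0)).
  apply: cvgB; last exact: cvg_cst.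
  apply: (@squeeze_cvgr _ _ _ _ (fun n => x - b%:R ^ (- n%:Z)) (cst x)).
  + near=> n; have := floor_itv (x * b%:R ^ n%:Z).
    rewrite intrD => /andP[fx xf]; have bn := bgt0 n.
    rewrite /= -invr_expz lerBlDr -[X in _ <= _ + X]mul1r -mulrDl.
    by rewrite ler_pdivlMr// ler_pdivrMr// fx ltW.
  + rewrite -[X in _ --> X]subr0; apply: cvgB; first exact: cvg_cst.
    exact: cvg_bVn.
  + exact: cvg_cst.
- rewrite (funext (fun n => digit_sum_pos x n b0)).
  rewrite -[X in _ --> X]subr0; apply: cvgB; first exact: cvg_cst.
  have xb0 : (x * b%:R ^ (- n%:Z) : R) @[n --> \oo] --> (0 : R).
    rewrite -[X in _ --> X](mulr0 x); apply: cvgM; first exact: cvg_cst.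
    exact: cvg_bVn.
  apply: cvg_near_cst; near=> n.
  have xb1 : x * b%:R ^ (- n%:Z) < 1.
    by near: n; apply: (cvgr_lt 0 xb0); exact: ltr01.
  rewrite (_ : Num.floor _ = 0) ?mul0r//.
  apply: floor_def; rewrite add0r xb1 andbT mulr_ge0// ltW// exprz_gt0 ?ltr0n.
Unshelve. all: by end_near. Qed.

Lemma digits_proper x N : (1 < b)%N ->
  exists2 k, (N <= k)%N & digit x (- k.+1%:Z) != b%:Z - 1.
Proof.
move=> b1; have b0 := ltnW b1.
have bn0 : b%:R != 0 :> R by rewrite pnatr_eq0 -lt0n.
apply: contrapT => noN.
have dN k : (N <= k)%N -> digit x (- k.+1%:Z) = b%:Z - 1.
  by move=> Nk; apply/eqP/negP => dk; apply: noN; exists k => //; exact/negP.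
pose F n : R := (Num.floor (x * b%:R ^ n%:Z))%:~R * b%:R ^ (- n%:Z).
have FE n : F (N + n)%N = F N + b%:R ^ (- N%:Z) - b%:R ^ (- (N + n)%:Z).
  elim: n => [|n IHn]; first by rewrite addn0 addrK.
  have := digit_telescope x (- (N + n).+1%:Z) b0.
  rewrite dN ?leq_addr// opprK (_ : - (N + n).+1%:Z + 1 = - (N + n)%:Z); last lia.
  rewrite opprK -/(F _) -/(F (N + n)%N) IHn => h.
  rewrite addnS.
  have e : b%:R ^ (- (N + n)%:Z) = b%:R * b%:R ^ (- (N + n).+1%:Z) :> R.
    rewrite -[X in X * _]expr1z -expfzDr//; congr (_ ^ _); lia.
  move: h; rewrite -/(F (N + n).+1) intrB e.
  by move=> h; lra.
have : F N + b%:R ^ (- N%:Z) <= x.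
  have : F N + b%:R ^ (- N%:Z) - b%:R ^ (- n%:Z) @[n --> \oo] --> F N + b%:R ^ (- N%:Z).
    rewrite -[X in _ --> X]subr0; apply: cvgB; first exact: cvg_cst.
    exact: cvg_bVn.
  move=> cv; rewrite -(cvg_lim _ cv)//; apply: limr_le.
    by apply/cvg_ex; eexists; exact: cv.
  near=> n; have Nn : (N <= n)%N by near: n; exact: nbhs_infty_ge.
  rewrite -(subnKC Nn) -FE /F -invr_expz ler_pdivrMr ?exprz_gt0 ?ltr0n//.
  exact: floor_le.
apply/negP; rewrite -ltNge /F -invr_expz -[X in _ < _ + X]mul1r -mulrDl.
rewrite ltr_pdivlMr ?exprz_gt0 ?ltr0n//.
by have := floorD1_gt (x * b%:R ^ N%:Z); rewrite intrD.
Unshelve. all: by end_near. Qed.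

Definition ominus x y : R := of_digits (digit_sub x y).

Definition ominus1 (j : nat) x : R := if odd j then ominus 0 x else x.

End digits.

Definition frac {R : realType} (x : R) : R := x - (Num.floor x)%:~R.

(* R^n; measurableTypeR R is R with its Borel sigma-algebra. *)
Notation Rn R n := (n.-tuple (measurableTypeR R)).

Section cube.
Variable R : realType.

(* Lebesgue measure on [0,1]^n, as a Borel probability measure on R^n carried by
   the cube. *)
Definition cube (n : nat) : probability (Rn R n) R :=
  tuple_prob (uniform_prob (@ltr01 R)) n.

End cube.

Section anova.
Context {R : realType} {d : nat}.
Implicit Types (u v : {set 'I_d}) (f : Rn R d -> R) (x : Rn R d).

(* The vector x_u, with the coordinates in u listed in increasing order. *)
Definition restr u x : Rn R #|u| := [tuple tnth x (enum_val i) | i < #|u|].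

(* The point x_u : y_{-u}. *)
Definition glue u (x : Rn R #|u|) (y : Rn R #|~: u|) : Rn R d :=
  [tuple if j \in u then nth (0 : R) x (index j (enum u))
         else nth (0 : R) y (index j (enum (~: u))) | j < d].

(* The integral of f over the coordinates outside u. As with every Rintegral, it
   is the fine part of the extended integral; for integrable f it is the genuine
   one for almost every x. *)
Definition int_out u f x : R :=
  \int[cube R #|~: u|]_y f (glue (restr u x) y).

(* The fuel n makes the recursion over proper subsets structural; anovaE is the
   defining recursion of the ANOVA effects. *)
Fixpoint anova_rec (n : nat) f u : Rn R d -> R :=
  if n is n'.+1 then
    int_out u (fun x => f x - \sum_(v : {set 'I_d} | v \proper u) anova_rec n' f v x)
  else cst 0.

Definition anova f u : Rn R d -> R := anova_rec #|u|.+1 f u.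

Lemma anovaE f u x :
  anova f u x =
  \int[cube R #|~: u|]_y
    (f (glue (restr u x) y) -
     \sum_(v : {set 'I_d} | v \proper u) anova f v (glue (restr u x) y)).
Proof.
have anova_recE n m v : (#|v| < n)%N -> (#|v| < m)%N ->
    anova_rec n f v = anova_rec m f v.
  elim: n m v => [//|n IHn] [//|m] v vn vm /=.
  apply/funext => z; apply: eq_Rintegral => y _; congr (_ - _).
  by apply: eq_bigr => w /proper_card wv; rewrite (IHn m) ?(leq_trans wv).
rewrite {1}/anova /= /int_out; apply: eq_Rintegral => y _; congr (_ - _).
by apply: eq_bigr => w /proper_card wu; rewrite (anova_recE _ #|w|.+1).
Qed.

End anova.

Section walsh.
Context {R : realType} {d : nat} (b p : nat).
Implicit Types (f : Rn R d -> R) (u : {set 'I_d}).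

Definition mu_wal f : R := \int[cube R d]_x f x.

(* (ominus 1)^j (x_j ominus x_{j+}), componentwise; ordS j is j + 1 mod p. *)
Definition cyclic_diff (n : nat) (x : p.-tuple (Rn R n)) (j : 'I_p) :
    Rn R n :=
  [tuple ominus1 b j (ominus b (tnth (tnth x j) i) (tnth (tnth x (ordS j)) i))
   | i < n].

Definition wal_form (F : 'I_p -> Rn R d -> R) : R :=
  \int[tuple_prob (cube R d) p]_x \prod_(j < p) F j (cyclic_diff x j).

Definition sigma_wal f : R := wal_form (fun=> f).

Definition lower_tau_wal u f : R :=
  (\int[(tuple_prob (cube R #|u|) p \x tuple_prob (cube R #|~: u|) p)%E]_xy
     \prod_(j < p)
       f (glue (map_tuple frac (cyclic_diff xy.1 j)) (tnth xy.2 j)))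
  - mu_wal f ^+ p.

End walsh.

(* Main.v *)
Require Import Defs.
From HB Require Import structures.
From mathcomp Require Import all_boot all_order all_algebra.
From mathcomp Require Import ring lra zify.
From mathcomp Require Import all_classical all_reals all_analysis.
From mathcomp Require Import measurable_realfun.

Set Implicit Arguments.
Unset Strict Implicit.
Unset Printing Implicit Defensive.
Import Order.TTheory GRing.Theory Num.Theory.
Import numFieldNormedType.Exports.
Local Open Scope classical_set_scope.
Local Open Scope ring_scope.
Local Notation glue := Defs.glue.
Local Notation frac := Defs.frac.

(** In the integral defining the left-hand side, the factor j contains a block
of variables y_{-u,j} that no other factor contains. Integrating it out
replaces f by its conditional mean given the coordinates in u
([int_prod_cond_exp]), and this mean is almost everywhere the sum of the ANOVA
effects f_v over the subsets v of u ([sum_anova_ae]). Expanding the product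
over j, the left-hand side becomes a sum, over all families (v_0, ...,
v_{p-1}) of subsets of u, of the cyclic integral of the product of the
functions f_{v_j}.

If the family is not constant, then somewhere around the cycle there is a
coordinate i in v_j but not in v_{j+} ([cyclic_subset_const]). The variable
x_{j+,i} occurs only in the differences j and j+, and f_{v_{j+}} does not
depend on coordinate i; so it occurs in the factor j alone. Digitwise
subtraction from a fixed number preserves the uniform distribution, hence
integrating over x_{j+,i} averages f_{v_j} over its coordinate i, which gives
0 ([anova_mean0], [int_prod_vanish]). The constant families give the terms of
the right-hand side.

Two facts support this argument. First, a map that permutes each base b digit
preserves the uniform distribution ([pushes_digit_map]): it permutes the b^n
digit words of length n, which are equally likely. Consequently every
difference (ominus 1)^j (x_j ominus x_{j+}) is uniformly distributed on the
cube. Second, all products that occur are integrable ([integrable_prod_Lpow]):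
a product of p numbers is at most the sum of the p-th powers of their absolute
values, and each factor is a function in L^p of a uniformly distributed point.
Conditional means, and with them the ANOVA effects, stay in L^p by the
inequality of Jensen ([Lpow_avg], [Lpow_anova]).

The conditional means, and the integrations over single variables of the
cyclic integral, are instances of one operation [avg], the mean over a
resampled part of the variables. *)

(** * Measure-preserving maps between probability spaces *)

Section pushes.
Context {R : realType}.

Lemma ae_measure_le d (X : measurableType d) (mu : probability X R)
    (B C : set X) : measurable B -> measurable C ->
  {ae mu, forall x, B x -> C x} -> (mu B <= mu C)%E.
Proof.
move=> mB mC [N [mN N0 BCN]]; apply: (@le_trans _ _ (mu (C `|` N))).
  apply: le_measure; rewrite ?inE//; first exact: measurableU.
  move=> x Bx; have [Cx|nCx] := pselect (C x); first by left.
  by right; apply: BCN => /(_ Bx).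
apply: (le_trans (measureU2 _ _ _)) => //.
by rewrite [X in (_ + X)%E](_ : _ = 0%E) ?adde0.
Qed.

(** The law of [phi] under [mu] is [nu]. Changes of variables are stated
through this predicate because the maps that occur (gluing, resampling,
digitwise subtraction) need not be bijective. *)
Definition pushes d1 d2 (X : measurableType d1) (Y : measurableType d2)
    (mu : probability X R) (nu : probability Y R) (phi : X -> Y) :=
  measurable_fun setT phi /\
  forall A, measurable A -> mu (phi @^-1` A) = nu A.

Section two.
Context d1 d2 (X : measurableType d1) (Y : measurableType d2)
  (mu : probability X R) (nu : probability Y R) (phi : X -> Y).
Hypothesis P : pushes mu nu phi.

Lemma pushes_ge0_int (h : Y -> \bar R) : measurable_fun setT h ->
  (forall y, (0 <= h y)%E) ->
  (\int[mu]_x h (phi x) = \int[nu]_y h y)%E.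
Proof.
move=> mh h0; have [mphi phiE] := P.
have := @ge0_integral_pushforward _ _ X Y R phi mphi mu setT h measurableT mh
  (fun y _ => h0 y).
rewrite preimage_setT => <-; apply: eq_measure_integral => A mA _.
exact: phiE.
Qed.

(** Positive and negative parts are transferred separately, so the identity
also holds when the integral is undefined and no integrability has to be
checked. *)
Lemma pushes_eint (h : Y -> \bar R) : measurable_fun setT h ->
  (\int[mu]_x h (phi x) = \int[nu]_y h y)%E.
Proof.
move=> mh; rewrite integralE [RHS]integralE; congr (_ - _)%E.
  by rewrite -(pushes_ge0_int (measurable_funepos mh)) // funepos_comp.
by rewrite -(pushes_ge0_int (measurable_funeneg mh)) // funeneg_comp.
Qed.

Lemma pushes_int (h : Y -> R) : measurable_fun setT h ->
  \int[mu]_x h (phi x) = \int[nu]_y h y.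
Proof.
move=> mh; congr fine; apply: (pushes_eint (h := EFin \o h)).
exact/measurable_EFinP.
Qed.

Lemma pushes_integrable (h : Y -> \bar R) : nu.-integrable setT h ->
  mu.-integrable setT (h \o phi).
Proof.
move=> /integrableP[mh hoo]; apply/integrableP; split.
  by apply: measurableT_comp => //; exact: P.1.
rewrite (pushes_ge0_int (h := fun y => `|h y|%E)) //.
exact: measurableT_comp.
Qed.

Lemma pushes_ae (Q : Y -> Prop) : {ae nu, forall y, Q y} ->
  {ae mu, forall x, Q (phi x)}.
Proof.
move=> [N [mN N0 NQ]]; exists (phi @^-1` N); split.
- by rewrite -[X in measurable X]setTI; apply: P.1.
- by rewrite P.2.
- by move=> x /= Qx; apply: NQ.
Qed.

Lemma pushes_ae_eq (phi' : X -> Y) : measurable_fun setT phi' ->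
  {ae mu, forall x, phi x = phi' x} -> pushes mu nu phi'.
Proof.
move=> mphi' phiE; split=> // A mA; rewrite -P.2//.
have m1 : measurable (phi @^-1` A).
  by rewrite -[X in measurable X]setTI; apply: P.1.
have m2 : measurable (phi' @^-1` A).
  by rewrite -[X in measurable X]setTI; apply: mphi'.
apply/eqP; rewrite eq_le; apply/andP; split; apply: ae_measure_le => //;
  by apply: filterS phiE => x /= ->.
Qed.

End two.

Lemma pushes_comp d1 d2 d3 (X : measurableType d1) (Y : measurableType d2)
    (Z : measurableType d3) (mu : probability X R) (nu : probability Y R)
    (la : probability Z R) (f : X -> Y) (g : Y -> Z) :
  pushes mu nu f -> pushes nu la g -> pushes mu la (g \o f).
Proof.
move=> [mf fE] [mg gE]; split; first exact: measurableT_comp.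
move=> A mA; rewrite -gE// -fE//.
by rewrite -[X in measurable X]setTI; apply: mg.
Qed.

Lemma pushes_id d1 (X : measurableType d1) (mu : probability X R) :
  pushes mu mu id.
Proof. by split. Qed.

Lemma pushes_fst d1 d2 (X : measurableType d1) (Y : measurableType d2)
  (mu : probability X R) (nu : probability Y R) :
  pushes (mu \x nu)%E mu fst.
Proof.
split=> // A mA; have := product_measure1E mu nu mA measurableT.
have -> : (mu A * nu setT)%E = mu A.
  by rewrite (_ : (nu setT) = 1%E) ?mule1//; exact: probability_setT.
move=> <-; congr (_ _).
by apply/seteqP; split=> -[x y] //= [].
Qed.

Lemma pushes_snd d1 d2 (X : measurableType d1) (Y : measurableType d2)
  (mu : probability X R) (nu : probability Y R) :
  pushes (mu \x nu)%E nu snd.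
Proof.
split=> // A mA; have := product_measure1E mu nu measurableT mA.
have -> : (mu setT * nu A)%E = nu A.
  by rewrite (_ : (mu setT) = 1%E) ?mul1e//; exact: probability_setT.
move=> <-; congr (_ _).
by apply/seteqP; split=> -[x y] //= [].
Qed.

Lemma ae_prod_section d1 d2 (X : measurableType d1) (Y : measurableType d2)
    (mu : probability X R) (nu : probability Y R) (Q : X * Y -> Prop) :
  {ae (mu \x nu)%E, forall z, Q z} ->
  {ae mu, forall x, {ae nu, forall y, Q (x, y)}}.
Proof.
move=> [N [mN N0 NQ]].
have : ae_eq mu setT (fun x => nu (xsection N x)) (cst 0%E).
  apply/ae_eq_integral_abs => //; first exact: measurable_fun_xsection.
  rewrite -[RHS]N0 /= /product_measure1; apply: eq_integral => x _.
  by rewrite gee0_abs.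
apply: filterS => x /(_ I) Nx; exists (xsection N x); split => //.
  exact: measurable_xsection.
by move=> y /= nQ; rewrite /xsection/= inE; apply: NQ.
Qed.

(** Fubini for laws: if almost every section of [f] has law [la], then so does
[f]. It reduces a statement about two independent variables to one variable,
the other being frozen. *)
Lemma pushes_sections d1 d2 d3 (X : measurableType d1) (Y : measurableType d2)
    (Z : measurableType d3)
    (mu : probability X R) (nu : probability Y R) (la : probability Z R)
    (f : X * Y -> Z) : measurable_fun setT f ->
  {ae mu, forall x, forall A, measurable A ->
     nu ((fun y => f (x, y)) @^-1` A) = la A} ->
  pushes (mu \x nu)%E la f.
Proof.
move=> mf H; split=> // A mA.
have mfA : measurable (f @^-1` A).
  by rewrite -[X in measurable X]setTI; apply: mf.
rewrite /= /product_measure1.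
rewrite (@ae_eq_integral _ _ _ _ _ (cst (la A)))//.
- rewrite integral_cst// [X in (_ * X)%E](_ : _ = 1%E) ?mule1//.
  exact: probability_setT.
- exact: measurable_fun_xsection.
- apply: filterS H => x /(_ _ mA) xE _ /=; rewrite -xE; congr (_ _).
  by apply/seteqP; split=> y; rewrite /xsection/= inE.
Qed.

End pushes.

(** * Averages over a resampled part *)

Section avg.
Context {R : realType} d1 d2 (X : measurableType d1) (S : measurableType d2)
  (mu : probability X R) (nu : probability S R) (phi : X * S -> X).
Implicit Type h : X -> R.

(** Mean of [h] after the argument [x] has been partly resampled by the
independent variable [s]. Conditional means on the cube and means over a
single row of the cyclic integral are both of this form. *)
Definition avg h x : R := \int[nu]_s h (phi (x, s)).

Hypothesis P : pushes (mu \x nu)%E mu phi.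

Let integrable_comp h : mu.-integrable setT (EFin \o h) ->
  (mu \x nu)%E.-integrable setT (fun z => (h (phi z))%:E).
Proof. exact: pushes_integrable. Qed.

(** Since [phi] has law [mu], integrability of [h] is integrability of [h \o
phi] on the product, and Fubini applies. *)
Lemma avg_integrable_section h : mu.-integrable setT (EFin \o h) ->
  {ae mu, forall x, nu.-integrable setT (fun s => (h (phi (x, s)))%:E)}.
Proof. by move=> /integrable_comp/ae_integrable1. Qed.

Lemma measurable_avg h : mu.-integrable setT (EFin \o h) ->
  measurable_fun setT (avg h).
Proof.
move=> /integrable_comp/measurable_fubini_F mF.
exact: (measurableT_comp (fine_measurable measurableT) mF).
Qed.

Lemma avgE_ae h : mu.-integrable setT (EFin \o h) ->
  {ae mu, forall x, (avg h x)%:E = \int[nu]_s (h (phi (x, s)))%:E}%E.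
Proof.
move=> /avg_integrable_section; apply: filterS => x hx.
by rewrite /avg fineK//; apply: integrable_fin_num.
Qed.

Lemma integrable_avg h : mu.-integrable setT (EFin \o h) ->
  mu.-integrable setT (EFin \o avg h).
Proof.
move=> hi; have /integrable_fubini_F Fi := integrable_comp hi.
have mF := measurable_int _ Fi.
have mA := measurable_avg hi.
apply/integrableP; split; first exact/measurable_EFinP.
case/integrableP: Fi => _; apply: le_lt_trans.
rewrite le_eqVlt; apply/orP; left; apply/eqP; apply: ae_eq_integral => //.
- by apply: measurableT_comp => //; exact/measurable_EFinP.
- exact: measurableT_comp.
- by apply: filterS (avgE_ae hi) => x xE _; rewrite /comp xE.
Qed.

Lemma int_avg h : mu.-integrable setT (EFin \o h) ->
  \int[mu]_x avg h x = \int[mu]_x h x.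
Proof.
move=> hi; have hpi := integrable_comp hi.
rewrite -(pushes_int P (h := h)); last by apply/measurable_EFinP; case/integrableP: hi.
congr fine; rewrite -(integral12_prod_meas1 hpi).
apply: ae_eq_integral => //.
- by apply/measurable_EFinP; exact: measurable_avg.
- exact: (measurable_fubini_F hpi).
- by apply: filterS (avgE_ae hi) => x xE _; rewrite xE.
Qed.

Lemma avg_ae_eq h h' : measurable_fun setT h -> measurable_fun setT h' ->
  {ae mu, forall x, h x = h' x} -> {ae mu, forall x, avg h x = avg h' x}.
Proof.
move=> mh mh' hh'; have := ae_prod_section (pushes_ae P hh').
apply: filterS => x xE; congr fine; apply: ae_eq_integral => //.
- apply/measurable_EFinP; apply: measurableT_comp => //.
  by apply: measurableT_comp; [exact: P.1|exact: pair1_measurable].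
- apply/measurable_EFinP; apply: measurableT_comp => //.
  by apply: measurableT_comp; [exact: P.1|exact: pair1_measurable].
- by apply: filterS xE => s /= -> _.
Qed.

End avg.

(** * Integrable p-th powers *)

Section Lpow.
Context {R : realType}.

Lemma ae_le_integrable d (X : measurableType d) (mu : probability X R)
    (f g : X -> R) : measurable_fun setT f ->
  {ae mu, forall x, `|f x| <= `|g x|} -> mu.-integrable setT (EFin \o g) ->
  mu.-integrable setT (EFin \o f).
Proof.
move=> mf fg /integrableP[mg goo]; apply/integrableP; split.
  exact/measurable_EFinP.
apply: le_lt_trans goo; apply: ae_ge0_le_integral => //.
- by apply: measurableT_comp => //; exact/measurable_EFinP.
- exact: measurableT_comp.
- by apply: filterS fg => x fgx _; rewrite lee_fin.
Qed.

Lemma prob_integrable_cst d (X : measurableType d) (mu : probability X R)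
  (k : R) : mu.-integrable setT (EFin \o (fun=> k)).
Proof. exact: finite_measure_integrable_cst. Qed.

Lemma prob_Rintegral_cst d (X : measurableType d) (mu : probability X R)
  (k : R) : \int[mu]_x k = k.
Proof.
by rewrite Rintegral_cst// [X in fine X](_ : _ = 1%E) ?mulr1//; exact: probability_setT.
Qed.

Lemma Rintegral_sum d (X : measurableType d) (mu : probability X R)
    (I : Type) (s : seq I) (P : pred I) (F : I -> X -> R) :
  (forall i, P i -> mu.-integrable setT (EFin \o F i)) ->
  mu.-integrable setT (EFin \o (fun x => \sum_(i <- s | P i) F i x)) /\
  \int[mu]_x (\sum_(i <- s | P i) F i x) =
  \sum_(i <- s | P i) \int[mu]_x F i x.
Proof.
move=> Fi; elim: s => [|i s [IHi IH]].
  split; last by rewrite big_nil; under eq_Rintegral do rewrite big_nil;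
    exact: prob_Rintegral_cst.
  apply: eq_integrable (prob_integrable_cst mu 0) => // x _.
  by rewrite /comp big_nil.
have [Pi|nPi] := boolP (P i); last first.
  split.
    by apply: eq_integrable IHi => // x _; rewrite /comp big_cons (negbTE nPi).
  rewrite big_cons (negbTE nPi) -IH; apply: eq_Rintegral => x _.
  by rewrite big_cons (negbTE nPi).
split.
  apply: eq_integrable (integrableD measurableT (Fi i Pi) IHi) => // x _.
  by rewrite /comp big_cons Pi EFinD.
rewrite big_cons Pi -IH -RintegralD//; last exact: Fi.
by apply: eq_Rintegral => x _; rewrite big_cons Pi.
Qed.

Lemma ae_eq_Rintegral d (X : measurableType d) (mu : probability X R)
    (f g : X -> R) : measurable_fun setT f -> measurable_fun setT g ->
  {ae mu, forall x, f x = g x} -> \int[mu]_x f x = \int[mu]_x g x.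
Proof.
move=> mf mg fg; congr fine; apply: ae_eq_integral => //.
- exact/measurable_EFinP.
- exact/measurable_EFinP.
- by apply: filterS fg => x -> _.
Qed.

Lemma ae_forall_fin d (X : measurableType d) (mu : probability X R)
    (I : finType) (Q : I -> X -> Prop) :
  (forall i, {ae mu, forall x, Q i x}) -> {ae mu, forall x, forall i, Q i x}.
Proof.
move=> H; have H' (s : seq I) : {ae mu, forall x, forall i, i \in s -> Q i x}.
  elim: s => [|i s IH]; first by apply: aeW.
  apply: filterS2 (H i) IH => x Qi IH j; rewrite inE => /predU1P[->//|].
  exact: IH.
by apply: filterS (H' (enum I)) => x Hx i; apply: Hx; rewrite mem_enum.
Qed.

(** The largest factor, say the one of index m, satisfies prod <= |a_m|^n.
This plays the role of the inequality of Hoelder with n equal exponents. *)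
Lemma ler_prod_sumX (n : nat) (a : 'I_n -> R) : (0 < n)%N ->
  \prod_(j < n) `|a j| <= \sum_(j < n) `|a j| ^+ n.
Proof.
case: n a => // n a _.
have [j0 _ Hj] := @arg_maxP _ _ _ ord0 predT (fun j => `|a j|) isT.
apply: (@le_trans _ _ (`|a j0| ^+ n.+1)).
  rewrite -[X in _ ^+ X](card_ord n.+1) -prodr_const.
  by apply: ler_prod => i _; rewrite normr_ge0/=; exact: Hj.
by rewrite (bigD1 j0)//= lerDl sumr_ge0// => i _; rewrite exprn_ge0.
Qed.

Lemma normr_le1DX (p : nat) (a : R) : (0 < p)%N -> `|a| <= 1 + `|a| ^+ p.
Proof.
move=> p0; have [a1|a1] := leP `|a| 1.
  by apply: (le_trans a1); rewrite lerDl exprn_ge0.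
apply: (@le_trans _ _ (`|a| ^+ p)); last by rewrite lerDr.
by rewrite -[leLHS]expr1; apply: ler_weXn2l => //; exact: ltW.
Qed.

Lemma normrD_expr_le (p : nat) (a b : R) :
  `|a + b| ^+ p <= 2 ^+ p * (`|a| ^+ p + `|b| ^+ p).
Proof.
wlog ab : a b / `|a| <= `|b|.
  move=> H; have [/H//|/ltW/H] := leP `|a| `|b|.
  by rewrite addrC [X in _ * X]addrC.
apply: (@le_trans _ _ ((2 * `|b|) ^+ p)).
  apply: lerXn2r; rewrite ?nnegrE// ?mulr_ge0//.
  apply: (le_trans (ler_normD _ _)); rewrite mulrDl mul1r.
  by rewrite lerD2r.
by rewrite exprMn ler_wpM2l ?exprn_ge0// lerDr exprn_ge0.
Qed.

(** A convex function lies above its tangent; integrating this inequality with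
a the mean of y gives the inequality of Jensen. *)
Lemma tangent_expr (p : nat) (a y : R) : 0 <= a -> 0 <= y ->
  a ^+ p.+1 + p.+1%:R * a ^+ p * (y - a) <= y ^+ p.+1.
Proof.
move=> a0 y0; elim: p => [|p IH]; first by rewrite !expr1 expr0; lra.
have := ler_wpM2l y0 IH; rewrite -exprS; apply: le_trans.
rewrite -subr_ge0.
rewrite (_ : _ - _ = p.+1%:R * a ^+ p * (y - a) ^+ 2); first
  by rewrite mulr_ge0// ?sqr_ge0// mulr_ge0// exprn_ge0.
rewrite !exprS -[in p.+2%:R]addn1 natrD expr0; ring.
Qed.

Definition Lpow d (X : measurableType d) (mu : probability X R) (p : nat)
    (h : X -> R) :=
  measurable_fun setT h /\
  mu.-integrable setT (fun x => (`|h x| ^+ p)%:E).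

Section one.
Context d (X : measurableType d) (mu : probability X R) (p : nat).
Hypothesis p0 : (0 < p)%N.
Local Notation Lpow := (Lpow mu p).

Lemma measurable_normX (h : X -> R) : measurable_fun setT h ->
  measurable_fun setT (fun x => `|h x| ^+ p).
Proof.
move=> mh; apply: measurable_funX.
by apply: measurableT_comp.
Qed.

Lemma Lpow_integrable h : Lpow h -> mu.-integrable setT (EFin \o h).
Proof.
move=> [mh ih].
apply: (@ae_le_integrable _ _ _ _ (fun x => 1 + `|h x| ^+ p)) => //.
  apply: aeW => x; rewrite [leRHS]ger0_norm ?addr_ge0 ?exprn_ge0//.
  exact: normr_le1DX.
apply: eq_integrable (integrableD measurableT (prob_integrable_cst mu 1) ih) => //.
Qed.

Lemma LpowD h h' : Lpow h -> Lpow h' -> Lpow (fun x => h x + h' x).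
Proof.
move=> [mh ih] [mh' ih']; split; first exact: measurable_funD.
apply: (@ae_le_integrable _ _ _ _ (fun x => 2 ^+ p * (`|h x| ^+ p + `|h' x| ^+ p))).
- exact/measurable_normX/measurable_funD.
- apply: aeW => x.
  rewrite normrX normr_id; apply: (le_trans (normrD_expr_le _ _ _)).
  exact: ler_norm.
- have := integrableZl measurableT (2 ^+ p) (integrableD measurableT ih ih').
  exact: eq_integrable.
Qed.

Lemma LpowN h : Lpow h -> Lpow (fun x => - h x).
Proof.
move=> [mh ih]; split; first exact: measurableT_comp.
by apply: eq_integrable ih => // x _; rewrite normrN.
Qed.

Lemma LpowB h h' : Lpow h -> Lpow h' -> Lpow (fun x => h x - h' x).
Proof. by move=> hL /LpowN; exact: LpowD. Qed.

Lemma Lpow0 : Lpow (fun=> 0).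
Proof.
split=> //; apply: eq_integrable (prob_integrable_cst mu 0) => // x _.
by rewrite normr0 expr0n gtn_eqF.
Qed.

Lemma Lpow_sum (I : Type) (s : seq I) (P : pred I) (F : I -> X -> R) :
  (forall i, P i -> Lpow (F i)) -> Lpow (fun x => \sum_(i <- s | P i) F i x).
Proof.
move=> FL; elim: s => [|i s IH].
  by rewrite (_ : (fun _ => _) = fun=> 0)//; [exact: Lpow0|
    apply/funext => x; rewrite big_nil].
have [Pi|nPi] := boolP (P i); last first.
  rewrite (_ : (fun _ => _) = fun x => \sum_(i <- s | P i) F i x)//.
  by apply/funext => x; rewrite big_cons (negbTE nPi).
rewrite (_ : (fun _ => _) = fun x => F i x + \sum_(i <- s | P i) F i x).
  exact: LpowD (FL _ Pi) IH.
by apply/funext => x; rewrite big_cons Pi.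
Qed.

(** Each F_j (W_j) has the same p-th absolute moment as F_j whatever the
dependence between the W_j, and a product of p numbers is dominated by the sum
of their p-th powers. *)
Lemma integrable_prod_Lpow d' (O : measurableType d') (P : probability O R)
    (W : 'I_p -> O -> X) (F : 'I_p -> X -> R) :
  (forall j, pushes P mu (W j)) -> (forall j, Lpow (F j)) ->
  P.-integrable setT (EFin \o (fun x => \prod_(j < p) F j (W j x))).
Proof.
move=> WP FL.
have mFW j : measurable_fun setT (fun x => F j (W j x)).
  by apply: measurableT_comp; [exact: (FL j).1|exact: (WP j).1].
apply: (@ae_le_integrable _ _ _ _ (fun x => \sum_(j < p) `|F j (W j x)| ^+ p)).
- exact: measurable_prod.
- apply: aeW => x; rewrite normr_prod [leRHS]ger0_norm; last first.
    by rewrite sumr_ge0// => j _; rewrite exprn_ge0.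
  exact: ler_prod_sumX.
- apply: (Rintegral_sum _ _).1 => j _.
  exact: (pushes_integrable (WP j) (FL j).2).
Qed.

Lemma jensen_normX (h : X -> R) : Lpow h ->
  `|\int[mu]_x h x| ^+ p <= \int[mu]_x (`|h x| ^+ p).
Proof.
move=> hL; have hi := Lpow_integrable hL; have [mh ih] := hL.
have hai : mu.-integrable setT (EFin \o (fun x => `|h x|)).
  exact: integrable_norm.
set a := \int[mu]_x `|h x|.
have a0 : 0 <= a by apply: Rintegral_ge0.
apply: (@le_trans _ _ (a ^+ p)).
  by apply: lerXn2r; rewrite ?nnegrE//; exact: le_normr_Rintegral.
case: p p0 ih {hL} => // q _ ih.
have i1 : mu.-integrable setT (EFin \o (fun x => `|h x| - a)).
  have := integrableB measurableT hai (prob_integrable_cst mu a).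
  exact: eq_integrable.
have i2 : mu.-integrable setT (EFin \o (fun x => q.+1%:R * a ^+ q * (`|h x| - a))).
  have := integrableZl measurableT (q.+1%:R * a ^+ q) i1.
  exact: eq_integrable.
have i3 : mu.-integrable setT
  (EFin \o (fun x => a ^+ q.+1 + q.+1%:R * a ^+ q * (`|h x| - a))).
  have := integrableD measurableT (prob_integrable_cst mu (a ^+ q.+1)) i2.
  exact: eq_integrable.
have -> : a ^+ q.+1 =
  \int[mu]_x (a ^+ q.+1 + q.+1%:R * a ^+ q * (`|h x| - a)).
  rewrite RintegralD//; last exact: prob_integrable_cst.
  rewrite RintegralZl// RintegralB//; last exact: prob_integrable_cst.
  by rewrite !prob_Rintegral_cst subrr mulr0 addr0.
by apply: le_Rintegral => // x _; exact: tangent_expr.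
Qed.

End one.

Lemma Lpow_avg d d' (X : measurableType d) (S : measurableType d')
    (mu : probability X R) (nu : probability S R) (phi : X * S -> X) (p : nat)
    (h : X -> R) : (0 < p)%N -> pushes (mu \x nu)%E mu phi ->
  Lpow mu p h -> Lpow mu p (avg nu phi h).
Proof.
move=> p0 P hL; have hi := Lpow_integrable p0 hL; have [mh ih] := hL.
have mA := measurable_avg P hi; split=> //.
apply: ae_le_integrable (integrable_avg P ih); first exact: measurable_normX.
have := avg_integrable_section P ih; apply: filterS => x sx.
rewrite normrX normr_id; apply: le_trans (ler_norm _).
apply: jensen_normX => //; split=> //.
apply: measurableT_comp => //.
by apply: measurableT_comp; [exact: P.1|exact: pair1_measurable].
Qed.

End Lpow.

(** * Product probabilities on tuples *)

Section tuple.
Context {R : realType}.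

Section unique.
Context d (T : measurableType d) (P : probability T R) (n : nat).

Let box (A : 'I_n -> set T) : set (n.-tuple T) :=
  [set t | forall i, A i (tnth t i)].

Let boxes : set (set (n.-tuple T)) :=
  [set box A | A in [set A | forall i, measurable (A i)]].

Let measurable_boxes : measurable = <<s boxes >>.
Proof.
apply/seteqP; split; last first.
  apply: smallest_sub; first exact: sigma_algebra_measurable.
  by move=> _ [A mA <-]; exact: measurable_tuple_box.
apply: sub_sigma_algebra2 => B; elim/big_rec: _ => [//|i C _ IH [|//]].
move=> [A mA <-]; rewrite setTI.
exists (fun j => if j == i then A else setT).
  by move=> j; case: ifP.
apply/seteqP; split=> t /= Ht; first by have := Ht i; rewrite eqxx.
by move=> j; case: eqP => // ->.
Qed.

(** Boxes form a pi-system generating the sigma-algebra of the tuples. *)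
Lemma tuple_prob_unique (Q : {measure set (n.-tuple T) -> \bar R}) :
  (forall A : 'I_n -> set T, (forall i, measurable (A i)) ->
     Q [set t | forall i, A i (tnth t i)] = (\prod_(i < n) P (A i))%E) ->
  forall B, measurable B -> Q B = tuple_prob P n B.
Proof.
move=> QE B mB.
have boxT : boxes setT.
  by exists (fun=> setT) => //; apply/seteqP; split.
apply: (@measure_unique _ R _ boxes (fun=> setT)) => //.
- move=> _ _ [A mA <-] [A' mA' <-]; exists (fun i => A i `&` A' i).
    by move=> i; exact: measurableI.
  apply/seteqP; split=> t /=; first by move=> H; split=> i; case: (H i).
  by move=> [H1 H2] i; split.
- by apply/seteqP; split=> // x _; exists 0%N.
- by move=> _ [A mA <-]; rewrite QE//; apply/esym; exact: tuple_prob_box.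
- move=> k; rewrite (_ : setT = [set t | forall i, (fun=> setT) i (tnth t i)]).
    rewrite (QE (fun=> setT))//.
    rewrite -(@tuple_prob_box _ _ _ P n (fun=> setT))//.
    apply: (le_lt_trans (probability_le1 _ _)); last exact: ltry.
    exact: (@measurable_tuple_box _ _ _ (fun=> setT)).
  by apply/seteqP; split.
Qed.

Lemma pushes_tuple d' (X : measurableType d') (mu : probability X R)
    (phi : X -> n.-tuple T) : measurable_fun setT phi ->
  (forall A : 'I_n -> set T, (forall i, measurable (A i)) ->
     mu [set x | forall i, A i (tnth (phi x) i)] = (\prod_(i < n) P (A i))%E) ->
  pushes mu (tuple_prob P n) phi.
Proof.
move=> mphi phiE; split=> // A mA.
pose phi' : {mfun X >-> n.-tuple T} :=
  HB.pack phi (isMeasurableFun.Build _ _ _ _ phi mphi).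
have /= <- := @tuple_prob_unique (distribution mu phi') _ A mA; first by [].
by move=> B mB; rewrite -phiE.
Qed.

End unique.

Lemma measurable_tupleP d d' (X : measurableType d) (T : measurableType d')
    (n : nat) (f : 'I_n -> X -> T) : (forall i, measurable_fun setT (f i)) ->
  measurable_fun setT (fun x => [tuple f i x | i < n]).
Proof.
move=> mf; apply/measurable_fun_tnthP => i.
rewrite (_ : _ \o _ = f i)//; apply/funext => x /=; by rewrite tnth_mktuple.
Qed.

(** Independence of the coordinates, by induction on their number. *)
Lemma ge0_int_tuple_prod d (T : measurableType d) (P : probability T R)
    (n : nat) (h : 'I_n -> T -> \bar R) :
  (forall i, measurable_fun setT (h i)) -> (forall i t, (0 <= h i t)%E) ->
  (\int[tuple_prob P n]_t \prod_(i < n) h i (tnth t i) =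
   \prod_(i < n) \int[P]_t h i t)%E.
Proof.
elim: n h => [|n IH] h mh h0.
  under eq_integral do rewrite big_ord0.
  rewrite big_ord0 integral_cst// mul1e; exact: probability_setT.
have mprod m (k : 'I_m -> T -> \bar R) : (forall i, measurable_fun setT (k i)) ->
    measurable_fun setT (fun t : m.-tuple T => \prod_(i < m) k i (tnth t i))%E.
  move=> mk; elim: (index_enum _) => [|i s IHs].
    by apply: (eq_measurable_fun (cst 1%E)) => // t _; rewrite big_nil.
  apply: (eq_measurable_fun (fun t : m.-tuple T =>
      k i (tnth t i) * \prod_(i <- s) k i (tnth t i))%E).
    by move=> t _; rewrite big_cons.
  apply: emeasurable_funM => //.
  exact: (measurableT_comp (mk i) (measurable_tnth i)).
rewrite [LHS]/= ge0_integral_distribution//; last 2 first.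
  - exact: mprod.
  - by move=> t; apply: prode_ge0.
rewrite big_ord_recl -(IH (fun i => h (lift ord0 i)))//.
have E z : (\prod_(i < n.+1) h i (tnth (tuple_cons z) i) =
    h ord0 z.1 * \prod_(i < n) h (lift ord0 i) (tnth z.2 i))%E.
  rewrite big_ord_recl tnth0; congr (_ * _)%E; apply: eq_bigr => i _.
  by rewrite tnthS.
under eq_integral do rewrite /comp E.
have mp : measurable_fun setT
  (fun t : n.-tuple T => \prod_(i < n) h (lift ord0 i) (tnth t i))%E.
  exact: (mprod _ (fun i => h (lift ord0 i))).
have p0 (t : n.-tuple T) : (0 <= \prod_(i < n) h (lift ord0 i) (tnth t i))%E.
  exact: prode_ge0.
rewrite fubini_tonelli1/=; last 2 first.
  - apply: emeasurable_funM; first exact: (measurableT_comp (mh ord0) measurable_fst).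
    exact: (measurableT_comp mp measurable_snd).
  - by move=> z; rewrite mule_ge0.
rewrite /fubini_F/=.
under eq_integral => x _ do rewrite ge0_integralZl//.
by rewrite ge0_integralZr//; apply: integral_ge0.
Qed.

Lemma pushes_map_tuple d d' (T : measurableType d) (V : measurableType d')
    (P : probability T R) (Q : probability V R) (n : nat) (phi : 'I_n -> T -> V) :
  (forall i, pushes P Q (phi i)) ->
  pushes (tuple_prob P n) (tuple_prob Q n)
    (fun x => [tuple phi i (tnth x i) | i < n]).
Proof.
move=> H; apply: pushes_tuple.
  apply: measurable_tupleP => i; apply: measurableT_comp; first exact: (H i).1.
  exact: measurable_tnth.
move=> A mA; transitivity (tuple_prob P n
    [set t | forall i, (fun i => phi i @^-1` A i) i (tnth t i)]).
  congr (_ _); apply/seteqP; split=> t /= Ht i; have := Ht i;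
    by rewrite tnth_mktuple.
rewrite (@tuple_prob_box _ _ _ P n (fun i => phi i @^-1` A i)); last first.
  by move=> i; rewrite -[X in measurable X]setTI; apply: (H i).1.
by apply: eq_bigr => i _; rewrite (H i).2.
Qed.

Lemma pushes_tnth d (T : measurableType d) (P : probability T R) (n : nat)
  (i : 'I_n) : pushes (tuple_prob P n) P (fun x => tnth x i).
Proof.
split; first exact: measurable_tnth.
move=> A mA; transitivity (tuple_prob P n
    [set t | forall j, (fun j => if j == i then A else setT) j (tnth t j)]).
  congr (_ _); apply/seteqP; split=> t /= Ht.
    by move=> j; case: eqP => // ->.
  by have := Ht i; rewrite eqxx.
rewrite (@tuple_prob_box _ _ _ P n (fun j => if j == i then A else setT));
  last by move=> j; case: ifP.
rewrite (bigD1 i)//= eqxx big1 ?mule1// => j /negbTE ->.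
exact: probability_setT.
Qed.

Lemma tuple_prob_ae d (T : measurableType d) (P : probability T R) (n : nat)
    (Q : T -> Prop) : {ae P, forall t, Q t} ->
  {ae tuple_prob P n, forall x, forall i, Q (tnth x i)}.
Proof. by move=> H; apply: ae_forall_fin => i; exact: pushes_ae (pushes_tnth P i) _ H. Qed.

(** With the first tuple frozen, the event that every phi_i lands in A_i is a
box, of probability the product over i of the measures of the sections; the
integral of that product factorizes by independence. *)
Lemma pushes_zip d d' d'' (T : measurableType d) (S : measurableType d')
    (V : measurableType d'') (P : probability T R) (Q : probability S R)
    (L : probability V R) (n : nat) (phi : 'I_n -> T * S -> V) :
  (forall i, pushes (P \x Q)%E L (phi i)) ->
  pushes (tuple_prob P n \x tuple_prob Q n)%E (tuple_prob L n)
    (fun z => [tuple phi i (tnth z.1 i, tnth z.2 i) | i < n]).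
Proof.
move=> H.
have mphi : measurable_fun setT (fun z : n.-tuple T * n.-tuple S =>
    [tuple phi i (tnth z.1 i, tnth z.2 i) | i < n]).
  apply: measurable_tupleP => i; apply: measurableT_comp; first exact: (H i).1.
  apply: measurable_fun_pair.
    exact: (measurableT_comp (measurable_tnth i) measurable_fst).
  exact: (measurableT_comp (measurable_tnth i) measurable_snd).
apply: pushes_tuple => // A mA.
have mB i : measurable (phi i @^-1` A i).
  by rewrite -[X in measurable X]setTI; apply: (H i).1.
rewrite /= /product_measure1.
transitivity (\int[tuple_prob P n]_x
   \prod_(i < n) Q (xsection (phi i @^-1` A i) (tnth x i)))%E.
  apply: eq_integral => x _; rewrite /comp -tuple_prob_box; last first.
    by move=> i; exact: measurable_xsection.
  congr (_ _); apply/seteqP; split=> y; rewrite /xsection /= inE /= => Hy i;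
    by have := Hy i; rewrite inE/= tnth_mktuple.
rewrite (@ge0_int_tuple_prod _ _ P n
  (fun i t => Q (xsection (phi i @^-1` A i) t)))//; last first.
  by move=> i; exact: measurable_fun_xsection.
by apply: eq_bigr => i _; rewrite -(H i).2.
Qed.

(** Coordinates of the first tuple on [u], of the second one off [u]; unlike
[Defs.glue] it needs no reindexing of the coordinates, so that composing two
of them is a boolean computation. *)
Definition mix (n : nat) T (u : {set 'I_n}) (z : n.-tuple T * n.-tuple T) :
  n.-tuple T := [tuple if i \in u then tnth z.1 i else tnth z.2 i | i < n].

Lemma pushes_mix d (T : measurableType d) (P : probability T R) (n : nat)
    (u : {set 'I_n}) :
  pushes (tuple_prob P n \x tuple_prob P n)%E (tuple_prob P n) (mix u).
Proof.
apply: (@pushes_zip _ _ _ _ _ _ _ _ _ n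
  (fun i z => if i \in u then z.1 else z.2)) => i.
by case: (i \in u); [exact: pushes_fst|exact: pushes_snd].
Qed.

End tuple.

Section glue.
Context {R : realType} {d : nat}.
Implicit Types (u : {set 'I_d}).
Local Notation U := (uniform_prob (@ltr01 R)).

Lemma tnth_glue_in u (x : Rn R #|u|) (y : Rn R #|~: u|) (k : 'I_#|u|) :
  tnth (glue x y) (enum_val k) = tnth x k.
Proof.
rewrite tnth_mktuple enum_valP (tnth_nth 0); congr nth.
by rewrite /enum_val index_uniq ?enum_uniq// -cardE.
Qed.

Lemma tnth_glue_out u (x : Rn R #|u|) (y : Rn R #|~: u|) (k : 'I_#|~: u|) :
  tnth (glue x y) (enum_val k) = tnth y k.
Proof.
have := enum_valP k; rewrite tnth_mktuple inE => /negbTE ->.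
rewrite (tnth_nth 0); congr nth.
by rewrite /enum_val index_uniq ?enum_uniq// -cardE.
Qed.

Lemma measurable_glue u : measurable_fun setT
  (fun z : Rn R #|u| * Rn R #|~: u| => glue z.1 z.2).
Proof.
apply/measurable_fun_tnthP => j; have [ju|nju] := boolP (j \in u).
  rewrite -(enum_rankK_in ju ju).
  rewrite (_ : _ \o _ = fun z => tnth z.1 (enum_rank_in ju j)).
    exact: (measurableT_comp (measurable_tnth _) measurable_fst).
  by apply/funext => z; rewrite /= tnth_glue_in.
have ju : j \in ~: u by rewrite inE.
rewrite -(enum_rankK_in ju ju).
rewrite (_ : _ \o _ = fun z => tnth z.2 (enum_rank_in ju j)).
  exact: (measurableT_comp (measurable_tnth _) measurable_snd).
by apply/funext => z; rewrite /= tnth_glue_out.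
Qed.

(** The event that the glued point lies in a box is a rectangle. *)
Lemma pushes_glue u : pushes (cube R #|u| \x cube R #|~: u|)%E (cube R d)
  (fun z => glue z.1 z.2).
Proof.
apply: pushes_tuple; first exact: measurable_glue.
move=> A mA.
transitivity ((cube R #|u| \x cube R #|~: u|)%E
  ([set x | forall k, (fun k : 'I_#|u| => A (enum_val k)) k (tnth x k)] `*`
   [set y | forall k, (fun k : 'I_#|~: u| => A (enum_val k)) k (tnth y k)])).
  congr (_ _); apply/seteqP; split=> -[x y] /=.
    move=> H; split=> k; first by have := H (enum_val k); rewrite tnth_glue_in.
    by have := H (enum_val k); rewrite tnth_glue_out.
  move=> [Hx Hy] j; have [ju|nju] := boolP (j \in u).
    by rewrite -(enum_rankK_in ju ju) tnth_glue_in.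
  have ju : j \in ~: u by rewrite inE.
  by rewrite -(enum_rankK_in ju ju) tnth_glue_out.
rewrite product_measure1E; last 2 first.
- exact: (@measurable_tuple_box _ _ _ (fun k : 'I_#|u| => A (enum_val k))).
- exact: (@measurable_tuple_box _ _ _ (fun k : 'I_#|~: u| => A (enum_val k))).
transitivity ((\prod_(k < #|u|) U (A (enum_val k))) *
   \prod_(k < #|~: u|) U (A (enum_val k)))%E.
  congr (_ * _)%E.
    exact: (@tuple_prob_box _ _ _ U _ (fun k : 'I_#|u| => A (enum_val k))).
  exact: (@tuple_prob_box _ _ _ U _ (fun k : 'I_#|~: u| => A (enum_val k))).
rewrite -!(big_enum_val (fun i => U (A i))).
rewrite [RHS](bigID (mem u))/=; congr (_ * _)%E.
by apply: eq_bigl => i; rewrite inE.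
Qed.

Lemma restr_glue u (x : Rn R #|u|) (y : Rn R #|~: u|) : restr u (glue x y) = x.
Proof. by apply: eq_from_tnth => k; rewrite tnth_mktuple tnth_glue_in. Qed.

Lemma restrC_glue u (x : Rn R #|u|) (y : Rn R #|~: u|) :
  restr (~: u) (glue x y) = y.
Proof. by apply: eq_from_tnth => k; rewrite tnth_mktuple tnth_glue_out. Qed.

Lemma glue_restr u (x y : Rn R d) :
  glue (restr u x) (restr (~: u) y) = mix u (x, y).
Proof.
apply: eq_from_tnth => j; rewrite [RHS]tnth_mktuple.
have [ju|nju] := boolP (j \in u).
  by rewrite -{1}(enum_rankK_in ju ju) tnth_glue_in tnth_mktuple enum_rankK_in.
have ju : j \in ~: u by rewrite inE.
by rewrite -{1}(enum_rankK_in ju ju) tnth_glue_out tnth_mktuple enum_rankK_in.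
Qed.

(** Integrating out the coordinates off [u] is resampling them: the remaining
coordinates of the fresh point of the cube are simply ignored. *)
Lemma int_outE u (h : Rn R d -> R) x : measurable_fun setT h ->
  int_out u h x = avg (cube R d) (mix u) h x.
Proof.
move=> mh; rewrite /avg.
have mmix : measurable_fun setT (fun y => h (mix u (x, y))).
  apply: measurableT_comp => //; apply: measurableT_comp.
    exact: (pushes_mix U u).1.
  exact: pair1_measurable.
rewrite -(pushes_int (pushes_glue u) mmix) /int_out.
have -> : (fun z : Rn R #|u| * Rn R #|~: u| => h (mix u (x, glue z.1 z.2))) =
   (fun z => h (glue (restr u x) z.2)).
  by apply/funext => -[a y]; rewrite -glue_restr restrC_glue.
rewrite (pushes_int (pushes_snd (cube R #|u|) (cube R #|~: u|))
   (h := fun y => h (glue (restr u x) y)))//.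
have mg : measurable_fun setT (fun y => glue (restr u x) y).
  exact: (measurableT_comp (@measurable_glue u) (pair1_measurable (restr u x))).
exact: (measurableT_comp mh mg).
Qed.

End glue.

(** * Measurability of digitwise subtraction *)

Section measurability.
Context {R : realType}.

(** No convergence is assumed: the sequence converges at [x] exactly when its
upper and lower limits are finite and equal, and elsewhere [limn] is a
constant. This covers digitwise subtraction of numbers of opposite signs,
whose series of digits diverges. *)
Lemma measurable_limn d (T : measurableType d) (h : nat -> T -> R) :
  (forall n, measurable_fun setT (h n)) ->
  measurable_fun setT (fun x => limn (h ^~ x)).
Proof.
move=> mh; pose u n x : \bar R := (h n x)%:E.
have mu n : measurable_fun setT (u n) by exact/measurable_EFinP.
pose s x := limn_esup (u ^~ x); pose i x := limn_einf (u ^~ x).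
have ms : measurable_fun setT s by exact: measurable_fun_limn_esup.
have mi : measurable_fun setT i.
  apply: measurableT_comp => //; apply: measurable_fun_limn_esup => n.
  exact: measurableT_comp.
have si_cvg x (l : R) : i x = l%:E -> s x = l%:E -> h ^~ x @ \oo --> l.
  rewrite /i /s limn_esup_lim limn_einf_lim => il sl.
  suff: u ^~ x @ \oo --> l%:E by move=> /fine_cvgP[].
  apply: (@squeeze_cvge _ _ _ _ (einfs (u ^~ x)) _ (esups (u ^~ x))).
  - apply: nearW => n; apply/andP; split.
      by apply: ereal_inf_lbound; exists n => /=.
    by apply: ereal_sup_ubound; exists n => /=.
  - by rewrite -il; apply: is_cvg_einfs.
  - by rewrite -sl; apply: is_cvg_esups.
have cvg_si x (l : R) : h ^~ x @ \oo --> l -> i x = l%:E /\ s x = l%:E.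
  move=> hl; have ul : u ^~ x @ \oo --> l%:E.
    by apply: cvg_EFin => //; exact: nearW.
  by have [il sl] := cvg_limn_einf_sup ul; split.
apply: (eq_measurable_fun (fun x =>
    if (s x == i x) && (s x \is a fin_num) then fine (s x) else point)).
  move=> x _; have [/andP[/eqP si sfin]|nc] := boolP (_ && _).
    apply/esym/cvg_lim => //; apply: si_cvg; rewrite ?fineK//.
  apply/esym/dvgP => -/cvg_ex[l /cvg_si[il sl]].
  by move: nc; rewrite il sl eqxx.
apply: measurable_fun_if => //.
- apply: measurable_and.
    exact: measurable_fun_eqe.
  apply: (measurable_fun_bool true).
  rewrite (_ : _ @^-1` _ = [set x | s x \is a fin_num]).
    exact: emeasurable_fin_num.
  by apply/seteqP; split=> x /=; case: (_ \is a fin_num).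
- exact/measurable_funTS/measurableT_comp.
Qed.

Context (b : nat) (b0 : (0 < b)%N).

Lemma measurable_floorR : measurable_fun setT (fun x : R => (Num.floor x)%:~R : R).
Proof.
apply: nondecreasing_measurable => // x y xy.
by rewrite ler_int le_floor.
Qed.

(** This is the telescoping identity of the digits divided by b^i. It exhibits
a digit as a combination of two monotone functions, hence measurable. *)
Lemma digit_floorE (x : R) i : (digit b x i)%:~R =
  (Num.floor (x * b%:R ^ (- i)))%:~R -
  b%:R * (Num.floor (x * b%:R ^ (- (i + 1))))%:~R :> R.
Proof.
have bn0 : b%:R != 0 :> R by rewrite pnatr_eq0 -lt0n.
have := digit_telescope x i b0.
rewrite expfzDr// expr1z mulrA mulrAC -mulrBl => /mulIf -> //.
  by rewrite [X in _ - X]mulrC.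
by rewrite expfz_eq0 (negbTE bn0) andbF.
Qed.

Lemma measurable_digit i : measurable_fun setT (fun x : R => (digit b x i)%:~R : R).
Proof.
under eq_fun do rewrite digit_floorE.
apply: measurable_funB; last apply: measurable_funM => //.
  by apply: (measurableT_comp measurable_floorR); exact: measurable_funM.
by apply: (measurableT_comp measurable_floorR); exact: measurable_funM.
Qed.

Lemma digit_subE (x y : R) i : (digit_sub b x y i)%:~R =
  (digit b x i)%:~R - (digit b y i)%:~R +
  (if (digit b x i)%:~R < (digit b y i)%:~R :> R then b%:R else 0) :> R.
Proof.
have /andP[x0 xb] := digit_itv x i b0.
have /andP[y0 yb] := digit_itv y i b0.
rewrite ltr_int /digit_sub; set a := digit b x i in x0 xb *.
set c := digit b y i in y0 yb *.
case: ltP => ac.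
  rewrite -modzDr modz_small; last by lia.
  by rewrite intrD intrB.
by rewrite modz_small ?intrB ?addr0//; lia.
Qed.

Lemma measurable_digit_sub i :
  measurable_fun setT (fun z : R * R => (digit_sub b z.1 z.2 i)%:~R : R).
Proof.
under eq_fun do rewrite digit_subE.
have m1 := measurableT_comp (measurable_digit i) (@measurable_fst _ _ R R).
have m2 := measurableT_comp (measurable_digit i) (@measurable_snd _ _ R R).
apply: measurable_funD; first exact: measurable_funB.
by apply: measurable_fun_ifT => //; exact: measurable_fun_ltr.
Qed.

Lemma measurable_ominus :
  measurable_fun setT (fun z : R * R => ominus b z.1 z.2).
Proof.
apply: measurable_funD; apply: measurable_limn => n;
  apply: measurable_sum => k; apply: measurable_funM => //;
  exact: measurable_digit_sub.
Qed.

Lemma measurable_ominus1 j : measurable_fun setT (fun x : R => ominus1 b j x).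
Proof.
rewrite /ominus1; case: (odd j) => //.
exact: (measurableT_comp measurable_ominus (pair1_measurable (0 : R))).
Qed.

Lemma measurable_frac : measurable_fun setT (fun x : R => frac x).
Proof. by apply: measurable_funB => //; exact: measurable_floorR. Qed.

End measurability.

(** * Digitwise maps preserve the uniform distribution *)

Section uniform.
Context {R : realType}.
Local Notation U := (uniform_prob (@ltr01 R)).

Lemma uniformE (A : set R) : measurable A ->
  U A = lebesgue_measure (A `&` `[0, 1]).
Proof.
move=> mA; rewrite /uniform_prob/= integral_uniform_pdf.
rewrite (eq_integral (cst 1%E)).
  by rewrite integral_cst ?mul1e//; exact: measurableI.
move=> x; rewrite inE => -[_]; rewrite /= in_itv/= => x01.
by rewrite /uniform_pdf x01 subr0 invr1.
Qed.

Lemma uniform_itv_le (x y : R) : x <= y -> (U `[x, y[ <= (y - x)%:E)%E.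
Proof.
move=> xy; rewrite uniformE//.
apply: (@le_trans _ _ (lebesgue_measure (`[x, y[ : set R))).
  by apply: le_measure; rewrite ?inE//; exact: measurableI.
rewrite lebesgue_measure_itv/= lte_fin; case: ifP => _; first by rewrite EFinB.
by rewrite lee_fin subr_ge0.
Qed.

Lemma uniform_ae01 : {ae U, forall x : measurableTypeR R, 0 <= (x : R) < 1}.
Proof.
exists (~` `[0, 1[); split; first exact: measurableC.
  rewrite uniformE; last exact: measurableC.
  rewrite [X in lebesgue_measure X](_ : _ = [set 1 : R]).
    exact: lebesgue_measure_set1.
  apply/seteqP; split=> x /=; rewrite !in_itv/=; last first.
    by move=> ->; rewrite ltxx ler01 lexx.
  move=> [/negP]; rewrite negb_and -ltNge -leNgt => /orP[x0 /andP[]|x1 /andP[_ x1']].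
    by rewrite leNgt x0.
  by apply/eqP; rewrite eq_le x1'.
by move=> x /= nx; rewrite in_itv/=.
Qed.

Lemma uniform_le01 (B C : set R) : measurable B -> measurable C ->
  (forall x, 0 <= x < 1 -> B x -> C x) -> (U B <= U C)%E.
Proof.
move=> mB mC BC; apply: ae_measure_le => //.
by apply: filterS uniform_ae01 => x /BC.
Qed.

End uniform.

Section digit_maps.
Context {R : realType} (b : nat) (b1 : (1 < b)%N).
Local Notation U := (uniform_prob (@ltr01 R)).
Implicit Types (s : nat -> int -> int) (x t : R).

Let b0 : (0 < b)%N := ltnW b1.
Let bR_gt0 : 0 < b%:R :> R. Proof. by rewrite ltr0n. Qed.
Let bR_neq0 : b%:R != 0 :> R. Proof. by rewrite gt_eqF. Qed.
Let w n : R := b%:R ^ (- n%:Z).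
Let w_gt0 n : 0 < w n. Proof. by rewrite exprz_gt0. Qed.
Let wS n : w n = b%:R * w n.+1.
Proof.
rewrite /w -[X in X * _]expr1z -expfzDr//; congr (_ ^ _); lia.
Qed.

Let w_cvg : w n @[n --> \oo] --> (0 : R).
Proof.
have : `|b%:R^-1 : R| < 1.
  by rewrite ger0_norm ?invr_ge0// invf_lt1 ?ltr1n.
move/cvg_expr; apply: cvg_trans; apply: near_eq_cvg; apply: nearW => n.
by rewrite /w -exprz_inv.
Qed.

Definition frac_digit x (k : nat) : int := digit b x (- k.+1%:Z).

(** Every [s k] permutes the digits: on a finite set an injection is a
bijection. *)
Definition digit_perms s := (forall k c, 0 <= c < b%:Z -> 0 <= s k c < b%:Z) /\
  (forall k c c', 0 <= c < b%:Z -> 0 <= c' < b%:Z -> s k c = s k c' -> c = c').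

Definition digit_psum s n x : R :=
  series (fun k : nat => (s k (frac_digit x k))%:~R * b%:R ^ (- k.+1%:Z) : R) n.

Definition digit_map s x : R := limn (fun n => digit_psum s n x).

Let frac_digit_itv x k : 0 <= frac_digit x k < b%:Z. Proof. exact: digit_itv. Qed.

Section digit_psum_bounds.
Variable s : nat -> int -> int.
Hypothesis Hs : digit_perms s.

Lemma digit_psumS n x :
  digit_psum s n.+1 x = digit_psum s n x + (s n (frac_digit x n))%:~R * w n.+1.
Proof. by rewrite /digit_psum seriesSr. Qed.

Lemma digit_psum_nd x : nondecreasing_seq (fun n => digit_psum s n x).
Proof.
apply/nondecreasing_seqP => n; rewrite digit_psumS lerDl.
apply: mulr_ge0; last exact: ltW.
by have /andP[] := Hs.1 n _ (frac_digit_itv x n); rewrite ler0z.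
Qed.

Lemma digit_psum_ub x n m : digit_psum s (n + m) x <= digit_psum s n x + w n - w (n + m).
Proof.
elim: m => [|m IH]; first by rewrite addn0 addrK.
rewrite addnS digit_psumS; apply: (le_trans (lerD IH (lexx _))).
have /andP[_ sb] := Hs.1 (n + m)%N _ (frac_digit_itv x (n + m)).
have : (s (n + m)%N (frac_digit x (n + m)))%:~R <= b%:R - 1 :> R.
  by rewrite -[b%:R]/(b%:Z%:~R) -[1]/(1%:~R) -intrB ler_int; lia.
move=> /(ler_wpM2r (ltW (w_gt0 (n + m).+1))); rewrite (wS (n + m)).
by move=> H; lra.
Qed.

Lemma is_cvg_digit_psum x : cvgn (fun n => digit_psum s n x).
Proof.
apply: nondecreasing_is_cvgn; first exact: digit_psum_nd.
exists (digit_psum s 0 x + w 0) => _ [n _ <-].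
apply: (le_trans (digit_psum_ub x 0 n)).
by rewrite lerBlDr lerDl ltW.
Qed.

Lemma digit_map_bounds x n : digit_psum s n x <= digit_map s x <= digit_psum s n x + w n.
Proof.
apply/andP; split.
  exact: (@nondecreasing_cvgn_le _ (fun n => digit_psum s n x) (digit_psum_nd x)
    (@is_cvg_digit_psum x) n).
apply: limr_le; first exact: is_cvg_digit_psum.
near=> m; have nm : (n <= m)%N by near: m; exact: nbhs_infty_ge.
rewrite -(subnKC nm); apply: (le_trans (digit_psum_ub x n (m - n))).
by rewrite lerBlDr lerDl ltW.
Unshelve. all: by end_near. Qed.

End digit_psum_bounds.

Lemma measurable_fun_int_comp (g : R -> int) (s : int -> int) :
  measurable_fun setT (fun x => (g x)%:~R : R) ->
  (forall x, 0 <= g x < b%:Z) ->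
  measurable_fun setT (fun x => (s (g x))%:~R : R).
Proof.
move=> mg gb.
apply: (eq_measurable_fun (fun x : R => \sum_(c < b)
   (s c%:Z)%:~R * (if (g x)%:~R == c%:R :> R then 1 else 0) : R)).
  move=> x _; have /andP[g0 gb'] := gb x.
  have cb : (absz (g x) < b)%N by lia.
  have gE : g x = (absz (g x))%:Z by lia.
  rewrite (bigD1 (Ordinal cb))//= -gE.
  have gR : (g x)%:~R = (absz (g x))%:R :> R.
    by rewrite -[RHS]/((absz (g x))%:Z%:~R) -gE.
  rewrite gR eqxx mulr1 -gR.
  rewrite big1 ?addr0// => c nc.
  rewrite -[c%:R]/(c%:Z%:~R) eqr_int; case: eqP => [gc|_]; last by rewrite mulr0.
  by case/eqP: nc; apply: val_inj => /=; rewrite gc.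
apply: measurable_sum => c; apply: measurable_funM => //.
apply: measurable_fun_if => //.
exact: measurable_fun_eqr.
Qed.

Lemma measurable_frac_digit k : measurable_fun setT (fun x => (frac_digit x k)%:~R : R).
Proof. exact: measurable_digit. Qed.

Lemma measurable_digit_psum s n : measurable_fun setT (digit_psum s n).
Proof.
apply: measurable_sum => k; apply: measurable_funM => //.
by apply: (measurable_fun_int_comp (s k) (measurable_frac_digit k)).
Qed.

Lemma measurable_digit_map s : measurable_fun setT (digit_map s).
Proof. by apply: measurable_limn => n; exact: measurable_digit_psum. Qed.

Let id_on : digit_perms (fun _ c => c). Proof. by split. Qed.

Lemma digit_psum_idE x n : 0 <= x < 1 ->
  digit_psum (fun _ c => c) n x = (Num.floor (x * b%:R ^ n%:Z))%:~R * w n.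
Proof.
move=> x01; elim: n => [|n IH].
  rewrite expr0z [x * 1]mulr1 (_ : Num.floor x = 0) ?mul0r.
    by rewrite /digit_psum /series/= big_geq.
  by apply: floor_def; rewrite add0r.
rewrite digit_psumS IH /frac_digit digit_telescope// opprK.
rewrite (_ : - n.+1%:Z + 1 = - n%:Z); last lia.
by rewrite opprK /w; ring.
Qed.

Lemma digit_psum_id_bounds x n : 0 <= x < 1 ->
  digit_psum (fun _ c => c) n x <= x < digit_psum (fun _ c => c) n x + w n.
Proof.
move=> x01; rewrite digit_psum_idE// -[X in _ < _ + X]mul1r -mulrDl.
rewrite /w -invr_expz ler_pdivrMr ?exprz_gt0// ltr_pdivlMr ?exprz_gt0//.
rewrite floor_le/=; have := floorD1_gt (x * b%:R ^ n%:Z).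
by rewrite intrD.
Qed.

Section cells.
Variable n : nat.
Let V := {ffun 'I_n -> 'I_b}.

Let cell (c : V) : set R :=
  [set x | (0 <= x < 1) /\ forall k : 'I_n, frac_digit x k = (c k)%:Z].

Let csum s (c : V) : R := \sum_(k < n) (s k (c k)%:Z)%:~R * w k.+1.

Let digit_psum_cell s c x : cell c x -> digit_psum s n x = csum s c.
Proof.
move=> [_ cx]; rewrite /digit_psum /series/= big_mkord; apply: eq_bigr => k _.
by rewrite cx.
Qed.

Let measurable_cell c : measurable (cell c).
Proof.
rewrite (_ : cell c = `[0, 1[%classic `&`
    \bigcap_(k in [set: 'I_n]) [set x | (frac_digit x k)%:~R = (c k)%:R :> R]).
  apply: measurableI => //; apply: fin_bigcap_measurable => // k _.
  by have := measurable_frac_digit k measurableT (measurable_set1 (c k)%:R);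
    rewrite setTI.
apply/seteqP; split=> x /=; rewrite in_itv/=.
  by move=> [x01 cx]; split=> // k _; rewrite /= cx.
move=> [x01 cx]; split=> // k; have /= := cx k I.
by rewrite -[(c k)%:R]/((c k)%:Z%:~R) => /eqP; rewrite eqr_int => /eqP.
Qed.

Let cell_le c : (U (cell c) <= (w n)%:E)%E.
Proof.
pose M := csum (fun _ c => c) c.
apply: (@le_trans _ _ (U `[M, M + w n[)).
  apply: le_measure; rewrite ?inE//; first exact: measurable_cell.
  move=> x cx; have [x01 _] := cx; have := digit_psum_id_bounds n x01.
  by rewrite (digit_psum_cell _ cx)/= in_itv/=.
have Mw : M <= M + w n by rewrite lerDl ltW.
by apply: (le_trans (uniform_itv_le Mw)); rewrite addrAC subrr add0r.
Qed.

Let U_cells (P : pred V) :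
  U (\bigcup_(c in [set` P]) cell c) = (\sum_(c | P c) U (cell c))%E.
Proof.
rewrite measure_fin_bigcup//; last first.
- by move=> c _; exact: measurable_cell.
- move=> c c' _ _ [x [[_ cx] [_ cx']]]; apply/ffunP => k; apply: val_inj.
  by have := cx k; rewrite cx' => -[].
rewrite (bigfs _ (index_enum_uniq V))//.
by move=> c _; rewrite mem_index_enum.
Qed.

Let cells_cover : \bigcup_(c in [set` predT : pred V]) cell c = `[0, 1[%classic.
Proof.
apply/seteqP; split=> x /=; first by move=> [c _ [x01 _]]; rewrite in_itv.
rewrite in_itv/= => x01.
have dlt (k : 'I_n) : (absz (frac_digit x k) < b)%N.
  by have := frac_digit_itv x k; lia.
exists [ffun k => Ordinal (dlt k)] => //; split=> // k; rewrite ffunE/=.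
by have := frac_digit_itv x k; lia.
Qed.

Let U_01 : U `[0, 1[ = 1%E.
Proof.
rewrite uniformE// setIidl; last first.
  by apply: subset_itvl; rewrite bnd_simp.
by rewrite lebesgue_measure_itv/= lte_fin ltr01 sube0.
Qed.

Let cell_eq c : U (cell c) = (w n)%:E.
Proof.
have fc c' : U (cell c') = (fine (U (cell c')))%:E.
  by rewrite fineK//; apply: fin_num_measure; exact: measurable_cell.
(* b^n cells of mass at most b^-n each have total mass 1 *)
have sum1 : \sum_(c' : V) fine (U (cell c')) = 1.
  apply: EFin_inj; rewrite -sumEFin -U_01 -cells_cover U_cells.
  by apply: eq_bigr => c' _; rewrite -fc.
have le c' : fine (U (cell c')) <= w n by rewrite -lee_fin -fc.
have : \sum_(c' : V) (w n - fine (U (cell c'))) = 0.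
  rewrite sumrB sum1 sumr_const card_ffun !card_ord -mulr_natr natrX.
  by rewrite /w -invr_expz -exprnP mulVf ?subrr// expf_neq0.
move=> /eqP; rewrite psumr_eq0; last by move=> c' _; rewrite subr_ge0.
move=> /allP/(_ c (mem_index_enum c))/= ; rewrite subr_eq0 => /eqP ->.
exact: fc.
Qed.

(** The first n digits of a uniform variable are uniformly distributed over
the b^n words of length n, a law invariant under the permutation of the words
induced by [s]. *)
Lemma digit_psum_law s t : digit_perms s ->
  U [set x | digit_psum s n x < t] = U [set x | digit_psum (fun _ c => c) n x < t].
Proof.
move=> Hs.
have E s' : U [set x | digit_psum s' n x < t] =
    (\sum_(c : V | (csum s' c < t)%R) (w n)%:E)%E.
  have mA : measurable [set x | digit_psum s' n x < t].
    rewrite (_ : [set _ | _] = digit_psum s' n @^-1` `]-oo, t[).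
      by rewrite -[X in measurable X]setTI; exact: measurable_digit_psum.
    by apply/seteqP; split=> x /=; rewrite in_itv.
  transitivity (U (\bigcup_(c in [set` (fun c => csum s' c < t)]) cell c)).
    transitivity (U ([set x | digit_psum s' n x < t] `&` `[0, 1[)).
      apply/eqP; rewrite eq_le; apply/andP; split; last first.
        by apply: le_measure; rewrite ?inE//; exact: measurableI.
      by apply: uniform_le01 => //; exact: measurableI.
    congr (U _); rewrite -cells_cover; apply/seteqP; split=> x /=.
      by move=> [xt [c _ cx]]; exists c => //;
      suff: csum s' c < t by []; rewrite -(digit_psum_cell s' cx).
    by move=> [c /= ct cx]; split; [rewrite (digit_psum_cell s' cx)|exists c].
  by rewrite U_cells; apply: eq_bigr => c _; rewrite cell_eq.
rewrite !E.
have Hlt k (i : 'I_b) : (absz (s k i%:Z) < b)%N.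
  have /Hs.1 : 0 <= i%:Z < b%:Z by rewrite ltz_nat ltn_ord.
  by move=> /(_ k); lia.
pose f (c : V) : V := [ffun k : 'I_n => Ordinal (Hlt k (c k))].
have ord_itv (i : 'I_b) : 0 <= i%:Z < b%:Z by rewrite ltz_nat ltn_ord.
have fE (c : V) k : (f c k)%:Z = s k (c k)%:Z.
  by rewrite ffunE/=; have := Hs.1 k _ (ord_itv (c k)); lia.
have f_inj : injective f.
  move=> c c' ff; apply/ffunP => k; apply: val_inj.
  have : s k (c k)%:Z = s k (c' k)%:Z by rewrite -!fE ff.
  by move=> /(Hs.2 _ _ _ (ord_itv _) (ord_itv _)) [].
rewrite [RHS](reindex_inj f_inj)/=; apply: eq_bigl => c.
by congr (_ < _); apply: eq_bigr => k _; rewrite fE.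
Qed.

End cells.

(** The first n digits determine both x and its image up to b^-n, and the
n-digit truncations have the same law. So the two distribution functions
differ at t by at most the uniform mass of an interval of length b^-n next to
t; let n grow. *)
Lemma pushes_digit_map s : digit_perms s ->
  pushes U U (digit_map s : measurableTypeR R -> measurableTypeR R).
Proof.
move=> Hs.
have md : measurable_fun setT (digit_map s : measurableTypeR R -> measurableTypeR R).
  exact: measurable_digit_map.
split=> // A mA.
pose phi' : {mfun (measurableTypeR R) >-> (measurableTypeR R)} :=
  HB.pack (digit_map s : measurableTypeR R -> measurableTypeR R)
    (isMeasurableFun.Build _ _ _ _
      (digit_map s : measurableTypeR R -> measurableTypeR R) md).
rewrite -[LHS]/(distribution U phi' A).
pose Gr := @RGenInftyO.G R.
apply: (@measure_unique _ R (measurableTypeR R) Gr (fun k => `]-oo, k%:R[%classic)) => //.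
- exact: RGenInftyO.measurableE.
- move=> _ _ [x ->] [y ->]; exists (Num.min x y).
  by apply/seteqP; split=> z /=; rewrite !in_itv/= lt_min;
    [move=> [-> ->]|move=> /andP].
- by move=> k; eexists.
- apply/seteqP; split=> // x _; exists (Num.truncn `|x|).+1 => //=.
  by rewrite in_itv/= (le_lt_trans (ler_norm _))// truncnS_gt.
- move=> _ [t ->]; rewrite /distribution/pushforward/=.
  have mI u : measurable (`]-oo, u[%classic : set R) by [].
  have mD u m : measurable [set x : R | digit_psum (fun _ c => c) m x < u].
    rewrite (_ : [set _ | _] = digit_psum (fun _ c => c) m @^-1` `]-oo, u[).
      by rewrite -[X in measurable X]setTI; exact: measurable_digit_psum.
    by apply/seteqP; split=> x /=; rewrite in_itv.
  have mD' u m : measurable [set x : R | digit_psum s m x < u].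
    rewrite (_ : [set _ | _] = digit_psum s m @^-1` `]-oo, u[).
      by rewrite -[X in measurable X]setTI; exact: measurable_digit_psum.
    by apply/seteqP; split=> x /=; rewrite in_itv.
  have mP u : measurable (digit_map s @^-1` `]-oo, u[).
    by rewrite -[X in measurable X]setTI; exact: measurable_digit_map.
  have Lip u v : u <= v -> (U `]-oo, v[ <= U `]-oo, u[ + (v - u)%:E)%E.
    move=> uv; apply: (@le_trans _ _ (U (`]-oo, u[ `|` `[u, v[))).
      apply: le_measure; rewrite ?inE//; first exact: measurableU.
      move=> x /=; rewrite !in_itv/= => xv.
      by have [xu|ux] := ltP x u; [left|right].
    apply: (le_trans (measureU2 _ _ _)) => //.
    by apply: leeD => //; exact: uniform_itv_le.
  have ub m : (U (digit_map s @^-1` `]-oo, t[) <= U `]-oo, t[ + (w m)%:E)%E.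
    apply: (@le_trans _ _ (U [set x | digit_psum s m x < t])).
      apply: uniform_le01 => // x _ /=; rewrite in_itv/= => xt.
      by have /andP[/le_lt_trans-> ] := digit_map_bounds Hs x m.
    rewrite digit_psum_law//.
    apply: (@le_trans _ _ (U `]-oo, t + w m[)).
      apply: uniform_le01 => // x x01 /=; rewrite in_itv/= => xt.
      by have /andP[_ /lt_trans->] := digit_psum_id_bounds m x01; rewrite ?ltrD2r.
    have tw : t <= t + w m by rewrite lerDl ltW.
    have e : t + w m - t = w m by rewrite addrAC subrr add0r.
    by have := Lip _ _ tw; rewrite e.
  have lb m : (U `]-oo, t[ <= U (digit_map s @^-1` `]-oo, t[) + (w m)%:E)%E.
    have tw : t - w m <= t by rewrite gerBl ltW.
    have e : t - (t - w m) = w m by rewrite opprB addrC addrNK.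
    apply: (le_trans (Lip _ _ tw)); rewrite e.
    apply: leeD => //.
    apply: (@le_trans _ _ (U [set x | digit_psum s m x < t - w m])).
      rewrite digit_psum_law//; apply: uniform_le01 => // x x01 /=; rewrite in_itv/= => xt.
      by have /andP[/le_lt_trans-> ] := digit_psum_id_bounds m x01.
    apply: uniform_le01 => // x _ /=; rewrite in_itv/= ltrBrDr => xt.
    by have /andP[_ /le_lt_trans->] := digit_map_bounds Hs x m.
  have eps e : (0 < e)%R -> exists m, w m <= e.
    move=> e0; have /cvgrPdist_le/(_ e e0) := w_cvg.
    move=> [m _ /(_ m (leqnn m))]; rewrite sub0r normrN (ger0_norm (ltW (w_gt0 m))).
    by exists m.
  apply/eqP; rewrite eq_le; apply/andP; split; apply/lee_addgt0Pr => e e0;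
    have [m we] := eps _ e0.
    by apply: (le_trans (ub m)); rewrite leeD2l// lee_fin.
  by apply: (le_trans (lb m)); rewrite leeD2l// lee_fin.
- move=> k; apply: (le_lt_trans (probability_le1 _ _)); last exact: ltry.
  exact: measurable_itv.
Qed.

Lemma digit_pos0 x (k : nat) : 0 <= x < 1 -> digit b x k%:Z = 0.
Proof.
move=> /andP[x0 x1]; rewrite /digit (_ : Num.floor _ = 0) ?mod0z//.
apply: floor_def; rewrite add0r -invr_expz mulr_ge0 ?invr_ge0 ?exprz_ge0//=.
rewrite ltr_pdivrMr ?exprz_gt0// mul1r (lt_le_trans x1)//.
by rewrite -exprnP exprn_ege1// ler1n.
Qed.

Lemma ominus_digit_map (x y : R) : 0 <= x < 1 -> 0 <= y < 1 ->
  ominus b x y = limn (series (fun k : nat =>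
     (digit_sub b x y (- k.+1%:Z))%:~R * b%:R ^ (- k.+1%:Z) : R)).
Proof.
move=> x01 y01; rewrite /ominus /of_digits [X in X + _](_ : _ = 0) ?add0r//.
rewrite (_ : series _ = fun=> 0) ?lim_cst//.
apply/funext => n; rewrite /series/= big1// => k _.
by rewrite /digit_sub !digit_pos0// subrr mod0z mul0r.
Qed.

Let subl_on (t : R) : digit_perms (fun k c => ((c - frac_digit t k) %% b%:Z)%Z).
Proof.
split=> k c; first by move=> _; rewrite modz_ge0 ?ltz_pmod // -lt0n.
move=> c' cb c'b /eqP; rewrite eqz_mod_dvd.
rewrite (_ : _ - _ = c - c'); last by ring.
by rewrite -eqz_mod_dvd !modz_small => [/eqP||].
Qed.

Let subr_on (t : R) : digit_perms (fun k c => ((frac_digit t k - c) %% b%:Z)%Z).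
Proof.
split=> k c; first by move=> _; rewrite modz_ge0 ?ltz_pmod // -lt0n.
move=> c' cb c'b /eqP; rewrite eqz_mod_dvd.
rewrite (_ : _ - _ = c' - c); last by ring.
rewrite -eqz_mod_dvd !modz_small => [/eqP|//|//]; exact: esym.
Qed.

(** Subtracting the k-th digit of [t] modulo b permutes the values of the k-th
digit. *)
Lemma pushes_ominusl (t : R) : 0 <= t < 1 ->
  pushes U U (fun x : measurableTypeR R => ominus b x t : measurableTypeR R).
Proof.
move=> t01; apply: (pushes_ae_eq (pushes_digit_map (subl_on t))).
  exact: (measurableT_comp (measurable_ominus b0) (pair2_measurable (t : R))).
by apply: filterS uniform_ae01 => x x01; rewrite ominus_digit_map.
Qed.

Lemma pushes_ominusr (t : R) : 0 <= t < 1 ->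
  pushes U U (fun x : measurableTypeR R => ominus b t x : measurableTypeR R).
Proof.
move=> t01; apply: (pushes_ae_eq (pushes_digit_map (subr_on t))).
  exact: (measurableT_comp (measurable_ominus b0) (pair1_measurable (t : R))).
by apply: filterS uniform_ae01 => x x01; rewrite ominus_digit_map.
Qed.

Lemma pushes_ominus1 j :
  pushes U U (fun x : measurableTypeR R => ominus1 b j x : measurableTypeR R).
Proof.
rewrite /ominus1; case: (odd j); last exact: pushes_id.
by apply: pushes_ominusr; rewrite lexx ltr01.
Qed.

End digit_maps.

(** * ANOVA effects as differences of conditional means *)

Section avg_linear.
Context {R : realType} d1 d2 (X : measurableType d1) (S : measurableType d2)
  (mu : probability X R) (nu : probability S R) (phi : X * S -> X).
Hypothesis P : pushes (mu \x nu)%E mu phi.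
Implicit Type h : X -> R.

Lemma avgB_ae h h' : mu.-integrable setT (EFin \o h) ->
  mu.-integrable setT (EFin \o h') ->
  {ae mu, forall x, avg nu phi (fun x => h x - h' x) x =
     avg nu phi h x - avg nu phi h' x}.
Proof.
move=> /(avg_integrable_section P) hi /(avg_integrable_section P).
apply: filterS2 hi => x hx h'x.
by rewrite /avg RintegralB.
Qed.

Lemma avg_sum_ae (I : finType) (Q : pred I) (F : I -> X -> R) :
  (forall i, Q i -> mu.-integrable setT (EFin \o F i)) ->
  {ae mu, forall x, avg nu phi (fun x => \sum_(i | Q i) F i x) x =
     \sum_(i | Q i) avg nu phi (F i) x}.
Proof.
move=> Fi.
have : {ae mu, forall x, forall i, Q i ->
    nu.-integrable setT (fun s => (F i (phi (x, s)))%:E)}.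
  apply: ae_forall_fin => i; have [Qi|nQi] := boolP (Q i); last exact: aeW.
  by apply: filterS (avg_integrable_section P (Fi i Qi)).
apply: filterS => x Hx; rewrite /avg.
by have [_ ->] := @Rintegral_sum R _ S nu I (index_enum I) Q
  (fun i s => F i (phi (x, s))) (fun i Qi => Hx i Qi).
Qed.

End avg_linear.

Section mix.
Context {R : realType} {d : nat}.
Local Notation C := (cube R d).
Local Notation U := (uniform_prob (@ltr01 R)).
Implicit Types (u v w : {set 'I_d}) (x y t : Rn R d) (h : Rn R d -> R).

Lemma tnth_mix (n : nat) T (u : {set 'I_n}) (z : n.-tuple T * n.-tuple T) i :
  tnth (mix u z) i = if i \in u then tnth z.1 i else tnth z.2 i.
Proof. by rewrite tnth_mktuple. Qed.

Lemma mix_mix u v x y t :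
  mix u (mix v (x, y), t) = mix (u :&: v) (x, mix u (y, t)).
Proof.
apply: eq_from_tnth => i; rewrite !tnth_mix/= ?tnth_mix/= inE.
by case: (i \in u) => //=; case: (i \in v).
Qed.

Definition depends u h :=
  forall x y, (forall i, i \in u -> tnth x i = tnth y i) -> h x = h y.

(** Conditional mean given the coordinates in [u] under the uniform
distribution. *)
Definition cond_exp u h := avg C (mix u) h.

Lemma cond_exp_depends u h : depends u (cond_exp u h).
Proof.
move=> x y xy; apply: eq_Rintegral => t _; congr h.
apply: eq_from_tnth => i; rewrite !tnth_mix/=.
by case: ifP => // iu; exact: xy.
Qed.

Lemma dependsS u v h : u \subset v -> depends u h -> depends v h.
Proof.
by move=> uv hu x y xy; apply: hu => i iu; apply: xy; exact: (fintype.subsetP uv).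
Qed.

Lemma cond_exp_id u h : depends u h -> cond_exp u h = h.
Proof.
move=> hu; apply/funext => x; rewrite /cond_exp /avg -[RHS](@prob_Rintegral_cst _ _ _ C).
by apply: eq_Rintegral => t _; apply: hu => i iu; rewrite tnth_mix iu.
Qed.

Lemma pushes_cube_mix u : pushes (C \x C)%E C (mix u).
Proof. exact: pushes_mix. Qed.

(** Tower property. Resampling off [v] and then off [u] amounts to replacing
all coordinates off [u :&: v] by those of [mix u (y, t)], which is again
uniform. *)
Lemma cond_exp_cond_exp u v h : C.-integrable setT (EFin \o h) ->
  {ae C, forall x, cond_exp v (cond_exp u h) x = cond_exp (u :&: v) h x}.
Proof.
move=> hi; apply: filterS (avg_integrable_section (pushes_cube_mix (u :&: v)) hi).
move=> x kx; transitivity (\int[C]_y avg C (mix u)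
  (fun s => h (mix (u :&: v) (x, s))) y); last exact: int_avg (pushes_cube_mix u) _ kx.
apply: eq_Rintegral => y _.
by apply: eq_Rintegral => t _; rewrite mix_mix.
Qed.

End mix.

Lemma anova_depends (R : realType) (d : nat) (f : Rn R d -> R) (u : {set 'I_d}) :
  depends u (anova f u).
Proof.
move=> x y xy; rewrite !anovaE; suff -> : restr u x = restr u y by [].
by apply: eq_from_tnth => k; rewrite !tnth_mktuple xy ?enum_valP.
Qed.

Section anova_facts.
Context {R : realType} {d p : nat}.
Hypothesis p0 : (0 < p)%N.
Local Notation C := (cube R d).
Local Notation Lp := (Lpow C p).
Implicit Types (u v w : {set 'I_d}).
Variable f : Rn R d -> R.
Hypothesis fL : Lp f.

Let Lp_int (h : Rn R d -> R) : Lp h -> C.-integrable setT (EFin \o h).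
Proof. exact: Lpow_integrable. Qed.

Lemma Lpow_cond_exp u h : Lp h -> Lp (cond_exp u h).
Proof. exact: (Lpow_avg p0 (pushes_cube_mix u)). Qed.

Let resid u x := f x - \sum_(v : {set 'I_d} | v \proper u) anova f v x.

Let anova_cond_exp_meas u : measurable_fun setT (resid u) ->
  anova f u = cond_exp u (resid u).
Proof.
move=> mr; apply/funext => x; rewrite anovaE -[LHS]/(int_out u (resid u) x).
exact: int_outE.
Qed.

Lemma Lpow_anova u : Lp (anova f u).
Proof.
have [n] := ubnP #|u|; elim: n u => // n IH u un.
have rL : Lp (resid u).
  apply: LpowB => //; apply: Lpow_sum => // v /proper_card vu.
  by apply: IH; rewrite (leq_trans vu).
rewrite anova_cond_exp_meas; first exact: Lpow_cond_exp.
exact: rL.1.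
Qed.

Let Lpow_resid u : Lp (resid u).
Proof. by apply: LpowB => //; apply: Lpow_sum => // v _; exact: Lpow_anova. Qed.

Let anova_cond_exp u : anova f u = cond_exp u (resid u).
Proof. exact: anova_cond_exp_meas (Lpow_resid u).1. Qed.

Let anova_ae u : {ae C, forall x, anova f u x = cond_exp u f x -
   \sum_(v : {set 'I_d} | v \proper u) anova f v x}.
Proof.
have sL : Lp (fun x => \sum_(v : {set 'I_d} | v \proper u) anova f v x).
  by apply: Lpow_sum => // v _; exact: Lpow_anova.
rewrite anova_cond_exp.
apply: filterS (avgB_ae (pushes_cube_mix u) (Lp_int fL) (Lp_int sL)) => x.
rewrite /cond_exp => ->; congr (_ - _).
rewrite -/(cond_exp u _) cond_exp_id// => y z yz; apply: eq_bigr => v /proper_sub vu.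
exact: (dependsS vu (@anova_depends R d f v)).
Qed.

(** The recursion defining [anova f u] subtracts the means of the [anova f v]
for [v] properly contained in [u], and these depend on the coordinates in [u]
only, so averaging leaves them unchanged. *)
Lemma sum_anova_ae u : {ae C, forall x,
  \sum_(v : {set 'I_d} | v \subset u) anova f v x = cond_exp u f x}.
Proof.
apply: filterS (anova_ae u) => x xE; rewrite (bigD1 u)//= xE.
rewrite (eq_bigl (fun v : {set 'I_d} => v \proper u)) ?subrK// => v.
by rewrite finset.properEneq andbC.
Qed.

(** Averaging over coordinate i maps the conditional mean given v to the one
given v minus i, which is the sum of the effects of the subsets of v that
avoid i. These are exactly the terms that survive, by induction, when the sum
over the proper subsets of v is averaged over i. *)
Lemma anova_mean0 v i : i \in v ->
  {ae C, forall x, cond_exp (~: [set i]) (anova f v) x = 0}.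
Proof.
have [n] := ubnP #|v|; elim: n v => // n IH v vn iv.
set K := ~: [set i].
have sL : Lp (fun x => \sum_(w : {set 'I_d} | w \proper v) anova f w x).
  by apply: Lpow_sum => // w _; exact: Lpow_anova.
have H1 := avg_ae_eq (pushes_cube_mix K) (Lpow_anova v).1
  (LpowB (Lpow_cond_exp v fL) sL).1 (anova_ae v).
have H2 := avgB_ae (pushes_cube_mix K) (Lp_int (Lpow_cond_exp v fL)) (Lp_int sL).
have H3 := avg_sum_ae (pushes_cube_mix K)
  (fun w (_ : w \proper v) => Lp_int (Lpow_anova w)).
(* averaging the conditional mean given v over coordinate i gives the one
   given v minus i *)
have H4 := cond_exp_cond_exp v K (Lp_int fL).
have H5 : {ae C, forall x, forall w : {set 'I_d}, w \proper v -> i \in w ->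
    cond_exp K (anova f w) x = 0}.
  apply: ae_forall_fin => w.
  have [/andP[wv iw]|nw] := boolP ((w \proper v) && (i \in w)).
    have wn : (#|w| < n)%N by exact: leq_trans (proper_card wv) vn.
    by apply: filterS (IH w wn iw).
  by apply: aeW => x wv iw; rewrite wv iw in nw.
have H6 := sum_anova_ae (v :&: K).
near=> x.
have -> : cond_exp K (anova f v) x = cond_exp K (fun x => cond_exp v f x -
    \sum_(w : {set 'I_d} | w \proper v) anova f w x) x by near: x.
have -> : cond_exp K (fun x => cond_exp v f x -
    \sum_(w : {set 'I_d} | w \proper v) anova f w x) x =
    cond_exp K (cond_exp v f) x - cond_exp K (fun x =>
      \sum_(w : {set 'I_d} | w \proper v) anova f w x) x by near: x.
have -> : cond_exp K (cond_exp v f) x = cond_exp (v :&: K) f x by near: x.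
have <- : \sum_(w : {set 'I_d} | w \subset v :&: K) anova f w x =
   cond_exp (v :&: K) f x by near: x.
have -> : cond_exp K (fun x =>
      \sum_(w : {set 'I_d} | w \proper v) anova f w x) x =
   \sum_(w : {set 'I_d} | w \proper v) cond_exp K (anova f w) x by near: x.
rewrite [X in _ - X](bigID (fun w : {set 'I_d} => i \in w))/=.
rewrite [X in _ - (X + _)]big1 ?add0r; last first.
  move=> w /andP[wv iw].
  have Hx : forall w : {set 'I_d}, w \proper v -> i \in w ->
    cond_exp K (anova f w) x = 0 by near: x.
  exact: Hx.
apply/eqP; rewrite subr_eq0; apply/eqP.
have subK (w : {set 'I_d}) : (w \subset K) = (i \notin w).
  by rewrite /K finset.subsetC finset.sub1set inE.
rewrite [RHS](eq_bigl (fun w : {set 'I_d} => w \subset v :&: K)); last first.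
  move=> w; rewrite finset.subsetI subK finset.properEneq.
  case: eqVneq => [->|_] /=; last by [].
  by rewrite iv andbF.
apply: eq_bigr => w; rewrite finset.subsetI => /andP[_ wK].
by rewrite cond_exp_id//; exact: dependsS wK (@anova_depends R d f w).
Unshelve. all: by end_near. Qed.

End anova_facts.

Lemma Lfun_Lpow (R : realType) d (X : measurableType d) (mu : probability X R)
    (p : nat) (h : X -> R) : (0 < p)%N ->
  h \in Lfun mu p%:R%:E -> Lpow mu p h.
Proof.
move=> p0; rewrite inE => /andP[]; rewrite !inE/= => mh.
rewrite /finite_norm unlock /Lnorm => hoo; split=> //.
have pR0 : (p%:R : R) != 0 by rewrite pnatr_eq0 -lt0n.
apply/integrableP; split.
  by apply/measurable_EFinP; exact: measurable_normX.
have := lty_poweRy _ hoo; rewrite invr_neq0// => /(_ isT).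
apply: le_lt_trans; rewrite le_eqVlt; apply/orP; left; apply/eqP.
apply: eq_integral => x _; rewrite gee0_abs ?lee_fin ?exprn_ge0//.
by rewrite poweR_EFin powR_mulrn.
Qed.

(** * Cyclic products of digitwise differences *)

Lemma measurable_prod_cond (R : realType) d (X : measurableType d) (n : nat)
    (Q : pred 'I_n) (T : 'I_n -> X -> R) : (forall l, measurable_fun setT (T l)) ->
  measurable_fun setT (fun x => \prod_(l < n | Q l) T l x).
Proof.
move=> mT; rewrite (_ : (fun _ => _) =
    fun x => \prod_(l < n) (if Q l then T l x else 1)).
  by apply: measurable_prod => l; case: (Q l).
by apply/funext => x; rewrite big_mkcond.
Qed.

(** If resampling affects the factor j only, the other factors can be pulled
out of the average. *)
Lemma int_prod_avg (R : realType) d1 d2 (X : measurableType d1)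
    (S : measurableType d2) (mu : probability X R) (nu : probability S R)
    (phi : X * S -> X) (n : nat) (T : 'I_n -> X -> R) (j : 'I_n) :
  pushes (mu \x nu)%E mu phi ->
  (forall l, measurable_fun setT (T l)) ->
  (forall l x s, l != j -> T l (phi (x, s)) = T l x) ->
  mu.-integrable setT (EFin \o (fun x => \prod_(l < n) T l x)) ->
  mu.-integrable setT (EFin \o T j) ->
  \int[mu]_x \prod_(l < n) T l x =
  \int[mu]_x ((\prod_(l < n | l != j) T l x) * avg nu phi (T j) x).
Proof.
move=> P mT Tphi iprod iT; rewrite -(int_avg P iprod).
apply: ae_eq_Rintegral.
- exact: (measurable_avg P iprod).
- apply: measurable_funM; last exact: (measurable_avg P iT).
  exact: measurable_prod_cond.
- apply: filterS (avg_integrable_section P iT) => x ix.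
  rewrite /avg -RintegralZl//; apply: eq_Rintegral => s _.
  rewrite (bigD1 j)//= mulrC; congr (_ * _); apply: eq_bigr => l lj.
  exact: Tphi.
Qed.

Section cyclic.
Context {R : realType} {d p b : nat}.
Hypothesis b1 : (1 < b)%N.
Hypothesis p1 : (1 < p)%N.
Let p0 : (0 < p)%N := ltnW p1.
Let b0 : (0 < b)%N := ltnW b1.
Local Notation U := (uniform_prob (@ltr01 R)).
Local Notation C := (cube R d).
Local Notation Om := (tuple_prob (cube R d) p).
Local Notation Lp := (Lpow C p).
Local Notation z j x := (cyclic_diff b x j).
Implicit Types (u v : {set 'I_d}) (j l : 'I_p) (x y : p.-tuple (Rn R d)).

Lemma ordS_neq j : ordS j != j.
Proof.
apply/eqP => /(congr1 val)/=; have jp := ltn_ord j.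
have [e|jp'] := eqVneq j.+1 p; rewrite ?e.
  by rewrite modnn => j0; move: e p1; rewrite -j0 => <-.
by rewrite modn_small; lia.
Qed.

Lemma tnth_cyclic_diff (n : nat) (x : p.-tuple (Rn R n)) j (i : 'I_n) :
  tnth (cyclic_diff b x j) i =
  ominus1 b j (ominus b (tnth (tnth x j) i) (tnth (tnth x (ordS j)) i)).
Proof. by rewrite tnth_mktuple. Qed.

Lemma measurable_tnth2 (n : nat) j (i : 'I_n) :
  measurable_fun setT (fun x : p.-tuple (Rn R n) => tnth (tnth x j) i).
Proof. exact: (measurableT_comp (measurable_tnth i) (measurable_tnth j)). Qed.

Lemma measurable_cyclic_diff (n : nat) j :
  measurable_fun setT (fun x : p.-tuple (Rn R n) => cyclic_diff b x j).
Proof.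
apply: measurable_tupleP => i.
have m2 := measurable_fun_pair (@measurable_tnth2 n j i) (@measurable_tnth2 n (ordS j) i).
have mo := measurableT_comp (measurable_ominus b0) m2.
exact: (measurableT_comp (measurable_ominus1 b0 j) mo).
Qed.

Lemma cube_ae01 (n : nat) :
  {ae cube R n, forall t, forall i, 0 <= (tnth t i : R) < 1}.
Proof. exact: tuple_prob_ae (@uniform_ae01 R). Qed.

Lemma O_ae01 : {ae Om, forall x, forall j i, 0 <= (tnth (tnth x j) i : R) < 1}.
Proof. exact: tuple_prob_ae (@cube_ae01 d). Qed.

(** The argument of the factor j in the definition of [lower_tau_wal], up to
fractional parts. The free coordinates y are drawn from row j of the same
sample: the coordinates off [u] of the rows occur nowhere else. *)
Definition mixed_diff u j x : Rn R d := mix u (z j x, tnth x j).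

Lemma measurable_mixed_diff u j : measurable_fun setT (mixed_diff u j).
Proof.
apply: (measurableT_comp (pushes_cube_mix u).1).
by apply: measurable_fun_pair; [exact: measurable_cyclic_diff|exact: measurable_tnth].
Qed.

(** With the row j+ frozen, the argument is a coordinatewise image of the row
j: digitwise subtraction of a constant, possibly followed by negation, on [u],
and the identity off [u]. *)
Lemma pushes_mixed_diff u j : pushes Om C (mixed_diff u j).
Proof.
split; first exact: measurable_mixed_diff.
(* Phi renews the row j and preserves the law of the sample, so the argument
   may be studied after this renewal, for fixed values of the other rows *)
pose Phi := @mix p (Rn R d) (~: [set j]).
have PhiP : pushes (Om \x Om)%E Om Phi by exact: pushes_mix.
suff H : pushes (Om \x Om)%E C (mixed_diff u j \o Phi).
  move=> A mA; rewrite -H.2// -PhiP.2//.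
  by rewrite -[X in measurable X]setTI; apply: measurable_mixed_diff.
apply: pushes_sections.
  by apply: measurableT_comp; [exact: measurable_mixed_diff|exact: PhiP.1].
apply: filterS O_ae01 => x x01.
pose tau (i : 'I_d) (t : measurableTypeR R) : measurableTypeR R :=
  if i \in u then ominus1 b j (ominus b t (tnth (tnth x (ordS j)) i)) else t.
have tauP i : pushes U U (tau i).
  rewrite /tau; case: (i \in u); last exact: pushes_id.
  exact: pushes_comp (pushes_ominusl b1 (x01 (ordS j) i)) (pushes_ominus1 b1 j).
have := (pushes_comp (pushes_tnth C j) (pushes_map_tuple tauP)).2.
move=> H A mA; rewrite -H//; congr (_ _); congr (_ @^-1` A).
apply/funext => y /=; apply: eq_from_tnth => i.
rewrite tnth_mktuple tnth_mix/= tnth_cyclic_diff !tnth_mix !inE/=.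
by rewrite eqxx/= ordS_neq.
Qed.

Lemma pushes_cyclic_diff j : pushes Om C (fun x => z j x).
Proof.
have := pushes_mixed_diff [set: 'I_d]%SET j; congr pushes; apply/funext => x.
by apply: eq_from_tnth => i; rewrite tnth_mix inE.
Qed.

Definition resample u j (xy : p.-tuple (Rn R d) * p.-tuple (Rn R d)) :
    p.-tuple (Rn R d) :=
  [tuple if l == j then mix u (tnth xy.1 l, tnth xy.2 l) else tnth xy.1 l
   | l < p].

Lemma tnth_resample u j x y l :
  tnth (resample u j (x, y)) l =
  if l == j then mix u (tnth x l, tnth y l) else tnth x l.
Proof. by rewrite tnth_mktuple. Qed.

Lemma pushes_resample u j : pushes (Om \x Om)%E Om (resample u j).
Proof.
apply: (@pushes_zip _ _ _ _ _ _ _ _ _ _ _ (fun l z => if l == j then mix u z else z.1)).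
move=> l; case: (l == j); [exact: pushes_cube_mix|exact: pushes_fst].
Qed.

Lemma int_row j (h : Rn R d -> R) : measurable_fun setT h ->
  \int[Om]_y h (tnth y j) = \int[C]_t h t.
Proof. exact: (pushes_int (pushes_tnth C j)). Qed.

Let Lp_int_comp (W : p.-tuple (Rn R d) -> Rn R d) (h : Rn R d -> R) :
  pushes Om C W -> Lp h -> Om.-integrable setT (EFin \o (fun x => h (W x))).
Proof. by move=> WP hL; exact: (pushes_integrable WP (Lpow_integrable p0 hL)). Qed.

Lemma avg_mixed_diff u j (h : Rn R d -> R) x : measurable_fun setT h ->
  avg Om (resample u j) (fun x => h (mixed_diff u j x)) x = cond_exp u h (mixed_diff u j x).
Proof.
move=> mh; rewrite /cond_exp /avg.
rewrite -(int_row j (h := fun t => h (mix u (mixed_diff u j x, t)))); last first.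
  apply: measurableT_comp => //.
  exact: (measurableT_comp (pushes_cube_mix u).1 (pair1_measurable _)).
apply: eq_Rintegral => y _; congr h; apply: eq_from_tnth => i.
rewrite /mixed_diff !tnth_mix/= !tnth_cyclic_diff !tnth_resample eqxx (negbTE (ordS_neq j)).
by rewrite !tnth_mix/=; case: (i \in u).
Qed.

Lemma mixed_diff_resample u j l x y : l != j ->
  mixed_diff u l (resample u j (x, y)) = mixed_diff u l x.
Proof.
move=> lj; apply: eq_from_tnth => i.
rewrite /mixed_diff !tnth_mix/= !tnth_cyclic_diff !tnth_resample (negbTE lj).
case: ifP => // iu; case: ifP => // _.
by rewrite tnth_mix/= iu.
Qed.

(** The coordinates off [u] of the row j enter the factor j alone; averaging
over them replaces F_j by its conditional mean. *)
Lemma int_prod_replace u (F : 'I_p -> Rn R d -> R) j : (forall l, Lp (F l)) ->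
  \int[Om]_x \prod_(l < p) F l (mixed_diff u l x) =
  \int[Om]_x \prod_(l < p) (if l == j then cond_exp u (F l) else F l) (mixed_diff u l x).
Proof.
move=> FL.
rewrite (int_prod_avg (j := j) (pushes_resample u j)).
- apply: eq_Rintegral => x _; rewrite [RHS](bigD1 j)//= eqxx mulrC.
  rewrite avg_mixed_diff; last exact: (FL j).1.
  by congr (_ * _); apply: eq_bigr => l /negbTE ->.
- move=> l; apply: measurableT_comp; first exact: (FL l).1.
  exact: measurable_mixed_diff.
- by move=> l x y lj; rewrite mixed_diff_resample.
- exact: (integrable_prod_Lpow p0 (fun l => pushes_mixed_diff u l) FL).
- exact: Lp_int_comp (pushes_mixed_diff u j) (FL j).
Qed.

Lemma int_prod_cond_exp u (f : Rn R d -> R) : Lp f ->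
  \int[Om]_x \prod_(l < p) f (mixed_diff u l x) =
  \int[Om]_x \prod_(l < p) cond_exp u f (mixed_diff u l x).
Proof.
move=> fL; have gL := Lpow_cond_exp p0 u fL.
(* the factors are averaged one after the other *)
pose F n (l : 'I_p) := if (l < n)%N then cond_exp u f else f.
have FL n l : Lp (F n l) by rewrite /F; case: ifP.
have H n : (n <= p)%N -> \int[Om]_x \prod_(l < p) f (mixed_diff u l x) =
    \int[Om]_x \prod_(l < p) F n l (mixed_diff u l x).
  elim: n => [_|n IH np]; first by apply: eq_Rintegral => x _; apply: eq_bigr.
  rewrite IH ?(ltnW np)// (int_prod_replace u (Ordinal np) (FL n)).
  apply: eq_Rintegral => x _; apply: eq_bigr => l _.
  suff -> : (if l == Ordinal np then cond_exp u (F n l) else F n l) = F n.+1 l by [].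
  rewrite /F -val_eqE/=; case: eqVneq => [->|ln]; first by rewrite ltnSn ltnn.
  by rewrite [in RHS]ltnS [in RHS]leq_eqVlt (negbTE ln).
rewrite (H p)//; apply: eq_Rintegral => x _; apply: eq_bigr => l _.
by rewrite /F ltn_ord.
Qed.

(** Coordinate i of the row j+ enters the differences j and j+ only, and the
factor j+ does not look at coordinate i. Renewing it therefore averages the
factor j alone, over coordinate i since subtraction from a fixed number
preserves the uniform distribution, and this average is 0. *)
Lemma int_prod_vanish (v : 'I_p -> {set 'I_d}) (F : 'I_p -> Rn R d -> R) j i :
  (forall l, Lp (F l)) -> (forall l, depends (v l) (F l)) ->
  {ae C, forall t, cond_exp (~: [set i]) (F j) t = 0} ->
  i \notin v (ordS j) ->
  \int[Om]_x \prod_(l < p) F l (z l x) = 0.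
Proof.
move=> FL Fv Fj0 iv; set K := ~: [set i].
have zR x y l : l != j -> l != ordS j ->
    z l (resample K (ordS j) (x, y)) = z l x.
  move=> lj lSj; apply: eq_from_tnth => k.
  rewrite !tnth_cyclic_diff !tnth_resample (negbTE lSj).
  by rewrite (inj_eq (can_inj (@ordSK p))) (negbTE lj).
rewrite (int_prod_avg (j := j) (pushes_resample K (ordS j))).
- rewrite -[RHS](@prob_Rintegral_cst _ _ _ Om); apply: ae_eq_Rintegral => //.
  + apply: measurable_funM.
      apply: (@measurable_prod_cond _ _ _ _ _ (fun l x => F l (z l x))) => l.
      apply: measurableT_comp; first exact: (FL l).1.
      exact: measurable_cyclic_diff.
    exact: (measurable_avg (pushes_resample K (ordS j))
      (Lp_int_comp (pushes_cyclic_diff j) (FL j))).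
  + apply: filterS2 O_ae01 (pushes_ae (pushes_cyclic_diff j) Fj0) => x x01 Fx.
    suff -> : avg Om (resample K (ordS j)) (fun x => F j (z j x)) x =
        cond_exp K (F j) (z j x) by rewrite Fx mulr0.
    pose rho (k : 'I_d) (t : measurableTypeR R) : measurableTypeR R :=
      ominus1 b j (ominus b (tnth (tnth x j) k) t).
    have rhoP k : pushes U U (rho k).
      exact: pushes_comp (pushes_ominusr b1 (x01 j k)) (pushes_ominus1 b1 j).
    rewrite /cond_exp /avg.
    have mk : measurable_fun setT (fun t => F j (mix K (z j x, t))).
      apply: measurableT_comp; first exact: (FL j).1.
      exact: (measurableT_comp (pushes_cube_mix K).1 (pair1_measurable _)).
    rewrite -(pushes_int (pushes_comp (pushes_tnth C (ordS j)) (pushes_map_tuple rhoP)) mk).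
    apply: eq_Rintegral => y _; congr (F j _); apply: eq_from_tnth => k.
    rewrite (tnth_cyclic_diff (resample K (ordS j) (x, y)) j k).
    rewrite (tnth_resample K (ordS j) x y j) (tnth_resample K (ordS j) x y (ordS j)).
    rewrite eqxx eq_sym (negbTE (ordS_neq j)).
    rewrite (tnth_mix K (tnth x (ordS j), tnth y (ordS j))).
    rewrite (tnth_mix K (z j x, _)) [(_, _).1]/= [(_, _).2]/=.
    rewrite (tnth_cyclic_diff x j k) tnth_mktuple [(_, _).1]/= [(_, _).2]/=.
    by case: (k \in K).
- move=> l; apply: measurableT_comp; first exact: (FL l).1.
  exact: measurable_cyclic_diff.
- move=> l x y lj; have [->|lSj] := eqVneq l (ordS j); last by rewrite zR.
  apply: Fv => k kv; rewrite !tnth_cyclic_diff !tnth_resample eqxx.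
  rewrite (negbTE (ordS_neq _)) tnth_mix/= !inE.
  by case: eqVneq => // ki; rewrite -ki kv in iv.
- exact: (integrable_prod_Lpow p0 pushes_cyclic_diff FL).
- exact: Lp_int_comp (pushes_cyclic_diff j) (FL j).
Qed.

(** Going once around the cycle, v_j is contained in every v_l. *)
Lemma cyclic_subset_const (v : 'I_p -> {set 'I_d}) :
  (forall j, v j \subset v (ordS j)) -> forall j l, v j = v l.
Proof.
move=> H.
have it n j : v j \subset v (iter n (@ordS p) j).
  elim: n => //= n IH; exact: fintype.subset_trans IH (H _).
have itE n j : iter n (@ordS p) j = ((j + n) %% p)%N :> nat.
  elim: n => [|n IH] /=; first by rewrite addn0 modn_small.
  by rewrite IH -[((j + n) %% p).+1]addn1 modnDml addn1 addnS.
have sub j l : v j \subset v l.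
  (* p - j steps lead from j to 0 modulo p, and l more steps lead to l *)
  have -> : l = iter (l + (p - j)) (@ordS p) j; last exact: it.
  apply: val_inj; rewrite /= itE addnCA subnKC 1?ltnW// modnDr modn_small//.
by move=> j l; apply/eqP; rewrite finset.eqEsubset !sub.
Qed.

Lemma tnth_restr u (t : Rn R d) k : tnth (restr u t) k = tnth t (enum_val k).
Proof. by rewrite tnth_mktuple. Qed.

Lemma restr_cyclic_diff u x j :
  restr u (z j x) = cyclic_diff b (map_tuple (restr u) x) j.
Proof.
apply: eq_from_tnth => k; rewrite tnth_restr (tnth_cyclic_diff x j).
rewrite (tnth_cyclic_diff (map_tuple (restr u) x) j k).
have rowE l : tnth (map_tuple (restr u) x) l = restr u (tnth x l).
  by rewrite tnth_map.
by rewrite !rowE !tnth_restr.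
Qed.

Lemma frac_id (x : R) : 0 <= x < 1 -> frac x = x.
Proof.
move=> x01; rewrite /Defs.frac (_ : Num.floor x = 0) ?subr0//.
by apply: floor_def; rewrite add0r.
Qed.

(** Gluing the rows x_j and y_j produces p independent uniform points of the
cube, and the fractional part is almost surely the identity. *)
Lemma lower_tau_mixed_diff u (f : Rn R d -> R) : Lp f ->
  lower_tau_wal b p u f + mu_wal f ^+ p =
  \int[Om]_x \prod_(l < p) f (mixed_diff u l x).
Proof.
move=> [mf _]; rewrite /lower_tau_wal subrK.
pose M j x : Rn R d :=
  glue (map_tuple frac (restr u (z j x))) (restr (~: u) (tnth x j)).
have mrestr (v : {set 'I_d}) : measurable_fun setT (@restr R d v).
  by apply: measurable_tupleP => k; exact: measurable_tnth.
have mM j : measurable_fun setT (M j).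
  have mmap (n : nat) : measurable_fun setT
      (fun t : Rn R n => map_tuple frac t : Rn R n).
    apply/measurable_fun_tnthP => k.
    have := measurableT_comp (@measurable_frac R) (@measurable_tnth _ (measurableTypeR R) n k).
    by apply: eq_measurable_fun => t _; rewrite /= tnth_map.
  have m1 := measurableT_comp (mmap #|u|)
    (measurableT_comp (mrestr u) (@measurable_cyclic_diff d j)).
  have m2 := measurableT_comp (mrestr (~: u)) (@measurable_tnth _ (Rn R d) p j).
  exact: (measurableT_comp (@measurable_glue R d u) (measurable_fun_pair m1 m2)).
have mG (W : 'I_p -> p.-tuple (Rn R d) -> Rn R d) :
    (forall j, measurable_fun setT (W j)) ->
    measurable_fun setT (fun x => \prod_(j < p) f (W j x)).
  by move=> mW; apply: measurable_prod => j _; exact: (measurableT_comp mf (mW j)).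
pose Z (xy : p.-tuple (Rn R #|u|) * p.-tuple (Rn R #|~: u|)) : p.-tuple (Rn R d) :=
  [tuple glue (tnth xy.1 j) (tnth xy.2 j) | j < p].
have ZP : pushes (tuple_prob (cube R #|u|) p \x tuple_prob (cube R #|~: u|) p)%E Om Z.
  exact: (@pushes_zip _ _ _ _ _ _ _ _ _ _ p (fun _ => fun t => glue t.1 t.2)
    (fun=> pushes_glue u)).
transitivity (\int[(tuple_prob (cube R #|u|) p \x tuple_prob (cube R #|~: u|) p)%E]_xy
    (fun x => \prod_(j < p) f (M j x)) (Z xy)).
  apply: eq_Rintegral => -[x y] _; apply: eq_bigr => j _; congr f.
  have Zx : map_tuple (restr u) (Z (x, y)) = x.
    by apply: eq_from_tnth => k; rewrite tnth_map tnth_mktuple restr_glue.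
  have Zy : restr (~: u) (tnth (Z (x, y)) j) = tnth y j.
    by rewrite tnth_mktuple restrC_glue.
  by rewrite /M restr_cyclic_diff Zx Zy.
transitivity (\int[Om]_x \prod_(j < p) f (M j x)).
  exact: (pushes_int ZP (mG M mM)).
apply: ae_eq_Rintegral; [exact: mG|apply: mG => j; exact: measurable_mixed_diff|].
have : {ae Om, forall x, forall j i, 0 <= (tnth (z j x) i : R) < 1}.
  apply: ae_forall_fin => j.
  exact: pushes_ae (pushes_cyclic_diff j) _ (@cube_ae01 d).
apply: filterS => x x01; apply: eq_bigr => j _; congr f.
rewrite /mixed_diff -glue_restr /M; congr (glue _ _).
by apply: eq_from_tnth => k; rewrite tnth_map tnth_mktuple frac_id.
Qed.

(** Expand the product of the sums of effects over all families s of subsets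
of u; only the constant families contribute. *)
Lemma lower_tau_anova u (f : Rn R d -> R) : Lp f ->
  lower_tau_wal b p u f + mu_wal f ^+ p =
  \sum_(v : {set 'I_d} | v \subset u) sigma_wal b p (anova f v).
Proof.
move=> fL; rewrite lower_tau_mixed_diff// int_prod_cond_exp//.
have aL v : Lp (anova f v) by exact: Lpow_anova.
transitivity (\int[Om]_x \prod_(l < p) cond_exp u f (z l x)).
  apply: eq_Rintegral => x _; apply: eq_bigr => l _.
  by apply: cond_exp_depends => i iu; rewrite /mixed_diff tnth_mix iu.
pose G (s : {ffun 'I_p -> {set 'I_d}}) x := \prod_(l < p) anova f (s l) (z l x).
have iG s : Om.-integrable setT (EFin \o G s).
  exact: (integrable_prod_Lpow p0 pushes_cyclic_diff (fun l => aL (s l))).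
pose Q := family (fun _ : 'I_p => [pred v : {set 'I_d} | v \subset u]).
have mz (h : Rn R d -> R) : measurable_fun setT h ->
    measurable_fun setT (fun x => \prod_(l < p) h (z l x)).
  move=> mh; apply: measurable_prod => l _.
  exact: (measurableT_comp mh (@measurable_cyclic_diff d l)).
transitivity (\int[Om]_x \sum_(s in Q) G s x).
  transitivity (\int[Om]_x \prod_(l < p)
      (\sum_(v : {set 'I_d} | v \subset u) anova f v (z l x))).
    apply: ae_eq_Rintegral.
    - exact: mz (Lpow_cond_exp p0 u fL).1.
    - apply: (mz (fun t => \sum_(v : {set 'I_d} | v \subset u) anova f v t)).
      have sL : Lp (fun t => \sum_(v : {set 'I_d} | v \subset u) anova f v t).
        by apply: Lpow_sum.
      exact: sL.1.
    - have := ae_forall_fin (fun j => pushes_ae (pushes_cyclic_diff j) (sum_anova_ae p0 fL u)).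
      by apply: filterS => x xE; apply: eq_bigr => l _; rewrite xE.
  apply: eq_Rintegral => x _.
  exact: (bigA_distr_big_dep (fun _ : 'I_p => [pred v : {set 'I_d} | v \subset u])
    (fun l v => anova f v (z l x))).
have [_ ->] := @Rintegral_sum R _ _ Om _ (index_enum {ffun 'I_p -> {set 'I_d}})
  (fun s => s \in Q) G (fun s _ => iG s).
pose j0 := Ordinal p0.
rewrite (bigID (fun s : {ffun 'I_p -> {set 'I_d}} => s == [ffun=> s j0]))/=.
rewrite [X in _ + X]big1 ?addr0; last first.
  move=> s /andP[_ sn].
  have [j /fintype.subsetPn[i ij inj]] : exists j, ~~ (s j \subset s (ordS j)).
    apply: contrapT => nex; move/negP: sn; apply; apply/eqP/ffunP => l.
    rewrite ffunE; apply: cyclic_subset_const => j.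
    by apply: contrapT => /negP nj; apply: nex; exists j.
  apply: (@int_prod_vanish s (fun l => anova f (s l)) j i) => //.
  - by move=> l; exact: (@anova_depends R d f).
  - exact: (anova_mean0 p0 fL ij).
(* constant families correspond to subsets v of u *)
rewrite (reindex_onto (fun v : {set 'I_d} => [ffun=> v])
  (fun s : {ffun 'I_p -> {set 'I_d}} => s j0))/=; last first.
  by move=> s /andP[_ /eqP <-].
apply: eq_big => v; last first.
  move=> _; apply: eq_Rintegral => x _; apply: eq_bigr => l _.
  by rewrite ffunE.
rewrite !ffunE !eqxx !andbT; apply/familyP/idP => [/(_ j0)|vu l].
  by rewrite ffunE.
by rewrite ffunE.
Qed.

End cyclic.


Local Close Scope classical_set_scope.

Theorem theorem3 (R : realType) (b d p : nat) (hb : (2 <= b)%N)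
    (hd : (1 <= d)%N) (hp : (2 <= p)%N) (f : Rn R d -> R)
    (hf : f \in Lfun (cube R d) p%:R%:E) (u : {set 'I_d}) :
  lower_tau_wal b p u f + mu_wal f ^+ p =
  \sum_(v : {set 'I_d} | v \subset u) sigma_wal b p (anova f v).
Proof. exact: (lower_tau_anova hb hp u (Lfun_Lpow (ltnW hp) hf)). Qed.
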